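(* With the notation of the context, the operator $\pi_-P\pi_-$ is invertible on $\mathcal R(\pi_-)$, i.e. it restricts to a bijection of $\mathcal R(\pi_-)$ onto itself with bounded inverse. Define the self-adjoint operator $B_-$ of $\mathcal H$ by $$B_-\phi=\pi_-(\pi_-P\pi_-)^{-1}\pi_-\phi ,\qquad \phi\in\mathcal H .$$ Then there exists a constant $C$ such that for all $\phi\in\mathcal H$ (respectively, for all $\phi\in \mathcal H$ with $\|\phi\|_{1/2}<\infty$) $$\|B_-\phi\|_{\mathcal H}\le C\|\pi_-\phi\|_{\mathcal H}\qquad\text{(respectively}\quad \|B_-\phi\|_{1/2}\le C\|\pi_-\phi\|_{1/2}).$$ The same statements hold with $\pi_-$ replaced by $\pi_+$, defining an operator $B_+$.
   Context: Let $\Omega\subset\mathbb R^2$ be a bounded connected Lipschitz domain whose boundary is partitioned (up to null sets) into $\Gamma_N,\Gamma_D,\Gamma_R,\Gamma_\sharp$ (Neumann, Dirichlet, Robin, periodic parts), each possibly empty, the nonempty ones having positive measure; $\Gamma_\sharp$ consists of pairs of opposite pieces identified by translations, and ''periodic on $\Gamma_\sharp$'' means that traces agree under this identification. Let $h\in L^\infty(\Omega)$, let $c,\sigma>0$ be scalar functions in $L^\infty(\Omega)$ with bounded inverses, and let $a>0$ be a constant. The constants are *controlled* if $\Gamma_D\cup\Gamma_R\neq\emptyset$, and *not controlled* otherwise. The *balanced case* is: constants not controlled and $\int_\Omega h=0$. Let $V=\{s\in H^1(\Omega): s=0\text{ on }\Gamma_D,\ s\text{ periodic on }\Gamma_\sharp\}$;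 let $H=V$ if the constants are controlled and $H=V/\mathbb R$ (quotient by constants) if not. Let $\mathcal H=L^2(\Omega)\times H$ with scalar product $$((u,s)|(u',s'))_{\mathcal H}=\int_\Omega (cuu'+\sigma\nabla s\cdot\nabla s')+\int_{\Gamma_R}a\,ss'.$$ Let $\mathcal A(u,s)=(c^{-1}hu-c^{-1}\operatorname{div}(\sigma\nabla s),\,u)$ (second component taken in $H$) with domain $\mathcal D(\mathcal A)$ the set of $(u,s)\in\mathcal H$ with $u\in V$, $\operatorname{div}(\sigma\nabla s)\in L^2(\Omega)$, $\sigma\nabla s\cdot n=0$ on $\Gamma_N$, $\sigma\nabla s\cdot n=-as$ on $\Gamma_R$, and $\sigma\nabla s$ having periodic flux on $\Gamma_\sharp$. $\mathcal A$ is self-adjoint and has an orthogonal Hilbert basis of eigenvectors of $\mathcal H$. Its nonzero eigenvalues, counted with multiplicity, are $\cdots\le\lambda_{-2}\le\lambda_{-1}<0<\lambda_1\le\lambda_2\le\cdots$, with $\lambda_{\pm n}\to\pm\infty$, and pairwise orthogonal eigenvectors $\phi_i=(U_i,\lambda_i^{-1}U_i)$, $i\in\mathbb Z\setminus\{0\}$. The kernel of $\mathcal A$ is $\{0\}$, except in the balanced case, where it is a line $\mathbb R\phi_0$ (and one puts $\lambda_0=0$). $P$ is the orthogonal projection $P(u,s)=(u,0)$ of $\mathcal H$. $\pi_+$ (resp. $\pi_-$) is the orthogonal projection of $\mathcal H$ onto the closed span of $\{\phi_i:i>0\}$ (resp. $\{\phi_i:i<0\}$), and $\mathcal R(\pi_\pm)=\pi_\pm(\mathcal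 H)$. The $\alpha$-norm is $\|\phi\|_\alpha^2=\sum_{i}|\lambda_i|^{2\alpha}\frac{(\phi_i|\phi)_{\mathcal H}^2}{\|\phi_i\|_{\mathcal H}^2}$, the sum running over $i\in\mathbb Z\setminus\{0\}$. *)

(* Defs.v *)
(* World: MathComp / MathComp-Analysis. *)
From HB Require Import structures.
From mathcomp Require Import all_boot all_order all_algebra.
From mathcomp Require Import all_classical all_reals all_analysis.

Set Implicit Arguments.
Unset Strict Implicit.
Unset Printing Implicit Defensive.
Import Order.TTheory GRing.Theory Num.Theory.
Import numFieldNormedType.Exports.
Local Open Scope classical_set_scope.
Local Open Scope ring_scope.

Notation plane R := (R * R)%type.

Section Plane.
Context {R : realType}.
Implicit Types (x y v n : plane R) (A O G : set (plane R)) (d : R).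

Definition leb2 :
    {measure set (measurableTypeR R * measurableTypeR R)%type -> \bar R} :=
  (lebesgue_measure \x lebesgue_measure)%E.

Definition dotp x y : R := x.1 * y.1 + x.2 * y.2.

(* [`| x |] on [R * R] is the sup norm; metric notions use the Euclidean one. *)
Definition enorm x : R := Num.sqrt (dotp x x).

Definition bdry A : set (plane R) := closure A `\` A^°.

Definition rot90 v : plane R := (- v.2, v.1).

Definition lipschitz_boundary O := forall x, bdry O x ->
  exists (e : plane R) (f : R -> R) (L r b : R),
    [/\ enorm e = 1, 0 < r, 0 < b,
        forall s t, `|f s - f t| <= L * `|s - t| &
        forall y, `|dotp (y - x) (rot90 e)| < r -> `|dotp (y - x) e| < b ->
          (O y <-> f (dotp (y - x) (rot90 e)) < dotp (y - x) e)].

Definition lipschitz_domain O :=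
  [/\ open O, O !=set0, connected O, bounded_set O & lipschitz_boundary O].

(* [n] is the outward unit normal at [x]: near [x], [O] fills every closed
   subcone of the open half-plane opposite to [n] and avoids those of the
   other one. On a Lipschitz boundary it exists almost everywhere. *)
Definition outer_normal O x n := enorm n = 1 /\
  forall eps, 0 < eps -> exists2 r, 0 < r &
    forall y, 0 < enorm (y - x) < r ->
      (dotp (y - x) n <= - eps * enorm (y - x) -> O y) /\
      (eps * enorm (y - x) <= dotp (y - x) n -> ~ O y).

Definition diam A : \bar R :=
  ereal_sup ([set 0%E] `|` [set (enorm (x.1 - x.2))%:E | x in A `*` A]).

Definition gauge d A : \bar R :=
  if (diam A <= d%:E)%E then diam A else +oo%E.

(* [mu_ext] is the Caratheodory extension by countable Borel covers; for
   Hausdorff measures these give the same value as arbitrary covers, since a set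
   and its closure have the same diameter. *)
Definition hausdorff1 A : \bar R :=
  ereal_sup [set mu_ext (gauge d) A | d in [set d | 0 < d]].

Lemma diam_ge0 A : (0 <= diam A)%E.
Proof. by apply: ereal_sup_ubound; left. Qed.

Lemma diam0 : diam set0 = 0%E.
Proof.
apply/eqP; rewrite eq_le diam_ge0 andbT; apply: ge_ereal_sup => z [->//|].
by case=> x [].
Qed.

Lemma gauge_ge0 d A : (0 <= gauge d A)%E.
Proof. by rewrite /gauge; case: ifP => // _; exact: diam_ge0. Qed.

Lemma gauge0 d : 0 < d -> gauge d set0 = 0%E.
Proof. by move=> d0; rewrite /gauge diam0 lee_fin ltW. Qed.

Lemma hausdorff10 : hausdorff1 set0 = 0%E.
Proof.
apply/eqP; rewrite eq_le; apply/andP; split.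
  apply: ge_ereal_sup => z [d d0 <-{z}].
  by rewrite mu_ext0//; [exact: gauge0|exact: gauge_ge0].
apply: (@le_trans _ _ (mu_ext (gauge 1) set0)).
  by apply: mu_ext_ge0 => A; exact: gauge_ge0.
by apply: ereal_sup_ubound; exists 1 => //=.
Qed.

Lemma hausdorff1_ge0 A : (0 <= hausdorff1 A)%E.
Proof.
apply: (@le_trans _ _ (mu_ext (gauge 1) A)).
  by apply: mu_ext_ge0 => B; exact: gauge_ge0.
by apply: ereal_sup_ubound; exists 1 => //=.
Qed.

Lemma le_hausdorff1 : {homo hausdorff1 : A B / A `<=` B >-> (A <= B)%E}.
Proof.
move=> A B AB; apply: ge_ereal_sup => z [d d0 <-{z}].
apply: (@le_trans _ _ (mu_ext (gauge d) B)); first exact: le_mu_ext.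
by apply: ereal_sup_ubound; exists d.
Qed.

Lemma hausdorff1_sigma_subadditive : sigma_subadditive hausdorff1.
Proof.
move=> F; apply: ge_ereal_sup => z [d d0 <-{z}].
have := mu_ext_sigma_subadditive (@gauge_ge0 d).
move=> /(_ F)/le_trans; apply; apply: lee_nneseries => [k _ _|k _].
  by apply: mu_ext_ge0 => A; exact: gauge_ge0.
by apply: ereal_sup_ubound; exists d.
Qed.

HB.instance Definition _ := isOuterMeasure.Build R (plane R) hausdorff1
  hausdorff10 hausdorff1_ge0 le_hausdorff1 hausdorff1_sigma_subadditive.

Definition hausdorff1_outer : {outer_measure set (plane R) -> \bar R} :=
  hausdorff1.

End Plane.

(* The plane with the sigma-algebra of the sets that are Caratheodory-measurable
   for [hausdorff1], on which [hausdorff1] is a (complete) measure. *)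
Notation hplane R := (caratheodory_type (@hausdorff1_outer R)).

Definition arclength {R : realType} : {measure set hplane R -> \bar R} :=
  (@hausdorff1_outer R : set (hplane R) -> \bar R).

Section Sobolev.
Context {R : realType}.
Implicit Types (O A : set (plane R)) (f g w d : plane R -> R).

Definition pd1 f : plane R -> R := fun x => 'D_((1, 0) : plane R) f x.
Definition pd2 f : plane R -> R := fun x => 'D_((0, 1) : plane R) f x.

Definition C1 f := [/\ forall x, derivable f x (1, 0),
  forall x, derivable f x (0, 1), continuous (pd1 f) & continuous (pd2 f)].

Definition test_fun O w := [/\ C1 w, compact (closure [set x | w x != 0]) &
  closure [set x | w x != 0] `<=` O].

Definition L2 O f := measurable_fun O f /\
  leb2.-integrable O (EFin \o (fun x => f x ^+ 2)).

Definition bL2 (A : set (hplane R)) (t : hplane R -> R) := measurable_fun A t /\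
  arclength.-integrable A (EFin \o (fun x => t x ^+ 2)).

Definition Linfty O f := measurable_fun O f /\
  exists M : R, {ae leb2, forall x, O x -> `|f x| <= M}.

Definition weak_gradient O f (g1 g2 : plane R -> R) :=
  forall w, test_fun O w ->
    \int[leb2]_(x in O) (f x * pd1 w x) = - (\int[leb2]_(x in O) (g1 x * w x)) /\
    \int[leb2]_(x in O) (f x * pd2 w x) = - (\int[leb2]_(x in O) (g2 x * w x)).

Definition weak_div O (F1 F2 d : plane R -> R) := forall w, test_fun O w ->
  \int[leb2]_(x in O) (F1 x * pd1 w x + F2 x * pd2 w x) =
  - (\int[leb2]_(x in O) (d x * w x)).

(* The trace is the continuous extension to H^1 of restriction to the boundary,
   defined first on (restrictions to [closure O] of) C^1 functions. *)
Definition has_trace O f (g1 g2 t : plane R -> R) :=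
  exists w : (plane R -> R)^nat,
  [/\ forall n, C1 (w n),
      (fun n => \int[leb2]_(x in O) (((w n x - f x) ^+ 2)%:E))%E @ \oo --> 0%E,
      (fun n => \int[leb2]_(x in O) (((pd1 (w n) x - g1 x) ^+ 2)%:E))%E
        @ \oo --> 0%E,
      (fun n => \int[leb2]_(x in O) (((pd2 (w n) x - g2 x) ^+ 2)%:E))%E
        @ \oo --> 0%E &
      (fun n => \int[arclength]_(x in bdry O) (((w n x - t x) ^+ 2)%:E))%E
        @ \oo --> 0%E].

End Sobolev.

(* An element of H^1 is carried together with representatives of its gradient
   and of its trace: a quadruple ((s, (d_1 s, d_2 s)), trace of s). The last
   three are determined by [s] up to null sets. *)
Definition sob (R : realType) : Type :=
  ((plane R -> R) * ((plane R -> R) * (plane R -> R)) * (plane R -> R))%type.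
HB.instance Definition _ (R : realType) := GRing.Lmodule.copy (sob R)
  ((plane R -> R) * ((plane R -> R) * (plane R -> R)) * (plane R -> R))%type.

Notation sfun s := s.1.1.
Notation sdx s := s.1.2.1.
Notation sdy s := s.1.2.2.
Notation str s := s.2.

Definition H1 {R : realType} (O : set (plane R)) : set (sob R) := [set s |
  [/\ L2 O (sfun s), L2 O (sdx s), L2 O (sdy s) &
      [/\ weak_gradient O (sfun s) (sdx s) (sdy s), bL2 (bdry O) (str s) &
          has_trace O (sfun s) (sdx s) (sdy s) (str s)]]].

(* Representatives (u, s) of elements of L^2 x H, see [HH] and [eqHH]. *)
Definition preHH (R : realType) : Type := ((plane R -> R) * sob R)%type.
HB.instance Definition _ (R : realType) := GRing.Lmodule.copy (preHH R)
  ((plane R -> R) * sob R)%type.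

Inductive bc_kind := Neumann | Dirichlet | Robin | Periodic.

(* The k-th periodic pair is [(piece k, shift k + piece k)]. *)
Record problem (R : realType) := Problem {
  Omega : set (plane R);
  Gamma : bc_kind -> set (plane R);
  npairs : nat;
  piece : 'I_npairs -> set (plane R);
  shift : 'I_npairs -> plane R;
  hh : plane R -> R;
  cc : plane R -> R;
  sg : plane R -> R;
  aa : R }.

Section Problem.
Context {R : realType} (p : problem R).
Let O := Omega p.

Definition side (kb : 'I_(npairs p) * bool) : set (plane R) :=
  if kb.2 then [set x + shift kb.1 | x in piece kb.1] else piece kb.1.

Record boundary_partition : Prop := BoundaryPartition {
  bp_sub : forall i, Gamma p i `<=` bdry O;
  bp_measurable : forall i, measurable (Gamma p i : set (hplane R));
  bp_cover : arclength (bdry O `\` \bigcup_i Gamma p i : set (hplane R)) = 0%E;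
  bp_disjoint : forall i j, i <> j ->
    arclength (Gamma p i `&` Gamma p j : set (hplane R)) = 0%E;
  bp_positive : forall i, Gamma p i = set0 \/
    (0 < arclength (Gamma p i : set (hplane R)))%E;
  bp_sides : Gamma p Periodic = \bigcup_kb side kb;
  bp_sides_measurable : forall kb, measurable (side kb : set (hplane R));
  bp_sides_disjoint : forall kb kb', kb <> kb' ->
    arclength (side kb `&` side kb' : set (hplane R)) = 0%E;
  bp_opposite : forall k : 'I_(npairs p), {ae arclength, forall x, piece k x ->
    forall n, outer_normal O x n -> 
      outer_normal O ((x : plane R) + shift k) (- n)} }.

Definition positive_bounded (f : plane R -> R) := measurable_fun O f /\
  exists m M : R, 0 < m /\ {ae leb2, forall x, O x -> m <= f x <= M}.

Record admissible : Prop := Admissible {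
  adm_domain : lipschitz_domain O;
  adm_boundary : boundary_partition;
  adm_h : Linfty O (hh p);
  adm_c : positive_bounded (cc p);
  adm_sigma : positive_bounded (sg p);
  adm_a : 0 < aa p }.

Definition controlled := Gamma p Dirichlet `|` Gamma p Robin !=set0.

Definition balanced := ~ controlled /\ \int[leb2]_(x in O) hh p x = 0.

Definition V : set (sob R) := [set s | [/\ H1 O s,
  {ae arclength, forall x, Gamma p Dirichlet x -> str s x = 0} &
  forall k : 'I_(npairs p), {ae arclength, forall x, piece k x ->
    str s ((x : plane R) + shift k) = str s x}]].

(* Equality in H: almost everywhere, modulo constants if these are not
   controlled. *)
Definition eqH (s s' : sob R) := exists2 k : R, (controlled -> k = 0) &
  {ae leb2, forall x, O x -> sfun s x - sfun s' x = k}.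

(* Equality in the Hilbert space is the relation [eqHH] on [HH]. *)
Definition HH : set (preHH R) := [set phi | L2 O phi.1 /\ V phi.2].

Definition eqHH (phi psi : preHH R) :=
  {ae leb2, forall x, O x -> phi.1 x = psi.1 x} /\ eqH phi.2 psi.2.

Definition ip (phi psi : preHH R) : R :=
  \int[leb2]_(x in O) (cc p x * phi.1 x * psi.1 x
    + sg p x * (sdx phi.2 x * sdx psi.2 x + sdy phi.2 x * sdy psi.2 x))
  + \int[arclength]_(x in (Gamma p Robin : set (hplane R)))
      (aa p * str phi.2 x * str psi.2 x).

Definition hnorm (phi : preHH R) : R := Num.sqrt (ip phi phi).

(* When [d = div (sigma grad s)], Green's formula makes this the pairing of the
   normal flux [sigma grad s . n] with the trace of [w]. *)
Definition normal_flux (s : sob R) (d : plane R -> R) (w : sob R) : R :=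
  \int[leb2]_(x in O) (sg p x * (sdx s x * sdx w x + sdy s x * sdy w x)
    + d x * sfun w x).

(* Against the test functions of [V], which vanish on the Dirichlet part and are
   periodic, a normal flux that is 0 on the Neumann part, [- a s] on the Robin
   part and periodic (hence opposite on two opposite sides, where the outward
   normals are opposite) reduces to its Robin contribution. *)
Definition flux_conditions (s : sob R) (d : plane R -> R) := forall w, V w ->
  normal_flux s d w =
  - (\int[arclength]_(x in (Gamma p Robin : set (hplane R)))
       (aa p * str s x * str w x)).

(* Graph of the unbounded operator: [opA phi psi] means that [phi] belongs to
   the domain and is mapped to [psi]. [v] is [phi.1] seen as an element of V. *)
Definition opA (phi psi : preHH R) := [/\ HH phi, HH psi &
  exists (v : sob R) (d : plane R -> R),
  [/\ V v /\ {ae leb2, forall x, O x -> sfun v x = phi.1 x},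
      L2 O d,
      weak_div O (fun x => sg p x * sdx phi.2 x)
                 (fun x => sg p x * sdy phi.2 x) d,
      flux_conditions phi.2 d &
      eqHH psi (fun x => (cc p x)^-1 * hh p x * phi.1 x - (cc p x)^-1 * d x,
                v)]].

Definition lincomb (phi : int -> preHH R) (s : seq int) (b : int -> R) : preHH R :=
  \sum_(i <- s) b i *: phi i.

Definition closed_span (I : set int) (phi : int -> preHH R) : set (preHH R) :=
  [set psi | HH psi /\ forall eps, 0 < eps -> exists (s : seq int) b,
    {in s, forall i, I i} /\ hnorm (psi - lincomb phi s b) < eps].

(* ([HH] modulo [eqHH], [ip]) is a Hilbert space: [ip] is a well-defined, definite
   scalar product on classes, and the space is complete. *)
Definition hilbert_space :=
  (forall phi, HH phi -> (ip phi phi = 0 <-> eqHH phi 0)) /\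
  (forall u : (preHH R)^nat, (forall n, HH (u n)) ->
    (forall eps, 0 < eps -> exists N, forall m n, (N <= m)%N -> (N <= n)%N ->
      hnorm (u m - u n) < eps) ->
    exists2 l, HH l & (fun n => hnorm (u n - l)) @ \oo --> 0).

(* A Hilbert basis is a basis of a Hilbert space. *)
Definition orthogonal_hilbert_basis (I : set int) (phi : int -> preHH R) :=
  [/\ hilbert_space,
      forall i, I i -> HH (phi i) /\ ~ eqHH (phi i) 0,
      forall i j, I i -> I j -> i != j -> ip (phi i) (phi j) = 0 &
      HH `<=` closed_span I phi].

(* Index 0 is used, for the kernel, in the balanced case only. The shape
   (U, U / lambda) of the eigenvectors follows from [es_eigen]. *)
Record eigensystem (lam : int -> R) (phi : int -> preHH R) : Prop := Eigensystem {
  es_eigen : forall i, i != 0 \/ balanced -> opA (phi i) (lam i *: phi i);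
  es_basis : orthogonal_hilbert_basis [set i | i != 0 \/ balanced] phi;
  es_kernel : balanced -> lam 0 = 0;
  es_pos : forall i, 0 < i -> 0 < lam i;
  es_neg : forall i, i < 0 -> lam i < 0;
  es_nondecreasing : forall i j, i != 0 -> j != 0 -> i <= j -> lam i <= lam j;
  es_pinfty : (fun n : nat => lam n%:Z) @ \oo --> +oo;
  es_ninfty : (fun n : nat => lam (- n%:Z)) @ \oo --> -oo }.

Definition projP (phi : preHH R) : preHH R := (phi.1, 0).

(* Orthogonal projection on [F], as a choice of representative. *)
Definition oproj (F : set (preHH R)) (phi : preHH R) : preHH R :=
  xget 0 [set psi | F psi /\ forall chi, F chi -> ip (phi - psi) chi = 0].

Section Spectral.
Variables (lam : int -> R) (phi : int -> preHH R) (I : set int).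

Definition spectral_proj : preHH R -> preHH R := oproj (closed_span I phi).

Definition spectral_range : set (preHH R) := [set psi | HH psi /\
  exists2 chi, HH chi & eqHH psi (spectral_proj chi)].

Definition compressP (psi : preHH R) : preHH R :=
  spectral_proj (projP (spectral_proj psi)).

Definition compressP_inv (psi : preHH R) : preHH R :=
  xget 0 [set chi | spectral_range chi /\ eqHH (compressP chi) psi].

Definition invertible_compressP :=
  [/\ forall psi, spectral_range psi -> spectral_range (compressP psi),
      forall psi chi, spectral_range psi -> spectral_range chi ->
        eqHH (compressP psi) (compressP chi) -> eqHH psi chi,
      forall psi, spectral_range psi ->
        exists2 chi, spectral_range chi & eqHH (compressP chi) psi &
      exists C : R, forall psi, spectral_range psi ->
        hnorm psi <= C * hnorm (compressP psi)].

Definition opB (psi : preHH R) : preHH R :=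
  spectral_proj (compressP_inv (spectral_proj psi)).

Definition selfadjoint_bounded (B : preHH R -> preHH R) :=
  [/\ forall psi, HH psi -> HH (B psi),
      forall psi chi, HH psi -> HH chi -> ip (B psi) chi = ip psi (B chi) &
      exists C : R, forall psi, HH psi -> hnorm (B psi) <= C * hnorm psi].

Definition alpha_norm (alpha : R) (psi : preHH R) : \bar R :=
  ((\esum_(i in [set i : int | i != 0%R])
     (`|lam i| `^ (2 * alpha) * ip (phi i) psi ^+ 2 / hnorm (phi i) ^+ 2)%:E)
   `^ 2^-1)%E.

Definition opB_estimates := exists C : R, forall psi, HH psi ->
  hnorm (opB psi) <= C * hnorm (spectral_proj psi) /\
  ((alpha_norm 2^-1 psi < +oo)%E ->
    (alpha_norm 2^-1 (opB psi)
      <= C%:E * alpha_norm 2^-1 (spectral_proj psi))%E).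

End Spectral.

End Problem.

(* Main.v *)
(* Let [G] be the compression of [P] to the range of [pi_-] or [pi_+], [M] the
   absolute value of [A] there, and [H] the compression of multiplication by
   [h] in the first component. Testing the eigenvalue equations against each
   other gives the Lyapunov equation [M G + G M = M + H] (up to the sign of
   [H]), so that [G = 1/2 + K] with [M K + K M = H]. As [H] is bounded by
   [kappa P], positivity of solutions of Lyapunov equations shows that
   [M^(1/2) K M^(1/2)] is bounded. If [G x = g], then [y = x - 2 g] satisfies
   [G y = - 2 K g]; testing this against [M y] bounds [y] by [g], first in the
   1/2-norm, and hence [x] by [g]. These bounds are uniform over finite sets of
   eigenvectors, so [G] is bounded below on the closed span; being symmetric, it
   is invertible. The 1/2-norm estimate for [G^-1] comes from [x = 2 g - 2 K x].

   Additivity of traces, hence bilinearity of the energy form on representatives,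
   requires continuous functions to be measurable for the one-dimensional
   Hausdorff measure; this is Caratheodory's criterion. *)
Require Import Defs.
From mathcomp Require Import all_boot all_order all_algebra.
From mathcomp Require Import all_classical all_reals all_analysis.
From mathcomp Require Import measurable_realfun ring lra.
Set Implicit Arguments.
Unset Strict Implicit.
Unset Printing Implicit Defensive.
Import Order.TTheory GRing.Theory Num.Theory.
Import numFieldNormedType.Exports.
Local Open Scope classical_set_scope.
Local Open Scope ring_scope.

(** * Finite quadratic forms and Lyapunov equations *)

Lemma quadratic_ge0 {R : realFieldType} (a b c : R) : 0 <= a ->
  (forall t, 0 <= t ^+ 2 * a + 2 * t * b + c) -> b ^+ 2 <= a * c.
Proof.
rewrite le_eqVlt => /orP[/eqP<-|a0] h.
  rewrite mul0r; have [->|b0] := eqVneq b 0; first by rewrite expr0n.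
  have := h (- (c + 1) / (2 * b)).
  have -> : (- (c + 1) / (2 * b)) ^+ 2 * 0 + 2 * (- (c + 1) / (2 * b)) * b + c = -1.
    by field.
  by lra.
have := mulr_ge0 (ltW a0) (h (- b / a)).
have -> : a * ((- b / a) ^+ 2 * a + 2 * (- b / a) * b + c) = a * c - b ^+ 2.
  by field; rewrite gt_eqF.
by rewrite subr_ge0.
Qed.

Section FiniteForms.
Context {R : realFieldType} {T : eqType}.
Implicit Types (A B : T -> T -> R) (x y z mu b : T -> R) (s t : seq T).

Definition bform s A x y : R := \sum_(i <- s) \sum_(j <- s) A i j * x i * y j.

Definition wnorm s w x : R := \sum_(i <- s) w i * x i ^+ 2.

Lemma eq_bform s A B x x' y y' : {in s &, A =2 B} -> {in s, x =1 x'} ->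
  {in s, y =1 y'} -> bform s A x y = bform s B x' y'.
Proof.
move=> AB xx yy; apply: eq_big_seq => i si; apply: eq_big_seq => j sj.
by rewrite AB// xx// yy.
Qed.

Lemma bformDl s A x x' y :
  bform s A (x \+ x') y = bform s A x y + bform s A x' y.
Proof.
rewrite -big_split; apply: eq_bigr => i _; rewrite -big_split.
by apply: eq_bigr => j _ /=; rewrite mulrDr mulrDl.
Qed.

Lemma bformZl s A a x y : bform s A (fun i => a * x i) y = a * bform s A x y.
Proof.
rewrite mulr_sumr; apply: eq_bigr => i _; rewrite mulr_sumr.
by apply: eq_bigr => j _; rewrite mulrCA !mulrA.
Qed.

Lemma bform_sym s A x y : {in s &, forall i j, A i j = A j i} ->
  bform s A x y = bform s A y x.
Proof.
move=> As; rewrite /bform exchange_big; apply: eq_big_seq => i si.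
by apply: eq_big_seq => j sj; rewrite As// mulrAC.
Qed.

Lemma bformD s A B x y :
  bform s (fun i j => A i j + B i j) x y = bform s A x y + bform s B x y.
Proof.
rewrite -big_split; apply: eq_bigr => i _; rewrite -big_split.
by apply: eq_bigr => j _ /=; rewrite !mulrDl.
Qed.

Lemma bformZ s A a x y :
  bform s (fun i j => a * A i j) x y = a * bform s A x y.
Proof.
rewrite mulr_sumr; apply: eq_bigr => i _; rewrite mulr_sumr.
by apply: eq_bigr => j _; rewrite !mulrA.
Qed.

Lemma bform_diag s b x y : uniq s ->
  bform s (fun i j => b i *+ (i == j)) x y = \sum_(i <- s) b i * x i * y i.
Proof.
move=> us; apply: eq_big_seq => i si.
rewrite (bigD1_seq i)//= eqxx big1 ?addr0// => j ji.
by rewrite eq_sym (negbTE ji) mulr0n !mul0r.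
Qed.

(* Schur product with the Cauchy matrix, equivalently positivity of the solution
   of a Lyapunov equation. Each step of the induction eliminates one index:
   [1/(mi+mj) = 2 m0/((mi+m0)(mj+m0))
                + (mi-m0)(mj-m0)/((mi+m0)(mj+m0)(mi+mj))]. *)
Lemma cauchy_bform_ge0 s mu B x : {in s, forall i, 0 < mu i} ->
  (forall y, 0 <= bform s B y y) ->
  0 <= bform s (fun i j => B i j / (mu i + mu j)) x x.
Proof.
move=> mu0 B0.
suff elim_supp t : {subset t <= s} -> forall y,
    {in s, forall i, i \notin t -> y i = 0} ->
    0 <= bform s (fun i j => B i j / (mu i + mu j)) y y.
  by apply: (elim_supp s) => // i ->.
elim: t => [|k t IH] ts y y0.
  rewrite [leRHS](_ : _ = 0)// /bform big1_seq// => i /andP[_ si].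
  by rewrite big1// => j _; rewrite y0// mulr0 mul0r.
have sk : k \in s by apply: ts; rewrite mem_head.
have k0 := mu0 _ sk.
pose u i := y i / (mu i + mu k).
pose v i := y i * (mu i - mu k) / (mu i + mu k).
have -> : bform s (fun i j => B i j / (mu i + mu j)) y y =
    2 * mu k * bform s B u u + bform s (fun i j => B i j / (mu i + mu j)) v v.
  rewrite -bformZ /bform -big_split.
  apply: eq_big_seq => i si; rewrite -big_split; apply: eq_big_seq => j sj /=.
  rewrite /u /v; have i0 := mu0 _ si; have j0 := mu0 _ sj.
  by field; rewrite !gt_eqF ?addr_gt0.
apply: addr_ge0; first by rewrite !mulr_ge0// ltW.
apply: IH => [i ti|i si it].
  by apply: ts; rewrite inE ti orbT.
have [->|ik] := eqVneq i k; first by rewrite /v subrr mulr0 mul0r.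
by rewrite /v y0 ?mul0r// inE (negbTE ik).
Qed.

End FiniteForms.

(* [G] is the matrix of the compression and [b] the squared norms of the basis
   vectors; [kG] is the Lyapunov equation [Mu G + G Mu = Mu b + H]. *)
Section Lyapunov.
Context {R : realFieldType} {T : eqType} (s : seq T).
Variables (G H : T -> T -> R) (b mu : T -> R) (m k : R).
Hypotheses (us : uniq s) (m0 : 0 < m) (k0 : 0 < k).
Hypothesis mum : {in s, forall i, m <= mu i}.
Hypothesis b0 : {in s, forall i, 0 <= b i}.
Hypothesis Gsym : {in s &, forall i j, G i j = G j i}.
Hypothesis kG : {in s &, forall i j,
  (mu i + mu j) * G i j = mu j * (b i *+ (i == j)) + H i j}.
Hypothesis HG : forall x, `|bform s H x x| <= k * bform s G x x.
Hypothesis Gb : forall x, bform s G x x <= wnorm s b x.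

Definition defect i j : R := G i j - b i *+ (i == j) / 2.

Definition hnegsq (x : T -> R) : R := wnorm s (fun i => b i / mu i) x.
Definition hpossq (x : T -> R) : R := wnorm s (fun i => mu i * b i) x.

Lemma mu_gt0 : {in s, forall i, 0 < mu i}.
Proof. by move=> i /mum; apply: lt_le_trans. Qed.

Lemma defectE : {in s &, forall i j, defect i j = H i j / (mu i + mu j)}.
Proof.
move=> i j si sj; rewrite /defect.
have i0 := mu_gt0 si; have j0 := mu_gt0 sj.
have -> : H i j = (mu i + mu j) * G i j - mu j * (b i *+ (i == j)).
  by rewrite kG// addrC addKr.
have [<-|_] := eqVneq i j; rewrite ?mulr1n ?mulr0n; field;
  by rewrite ?gt_eqF ?addr_gt0.
Qed.

Lemma defect_sym : {in s &, forall i j, defect i j = defect j i}.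
Proof.
move=> i j si sj; rewrite /defect Gsym// eq_sym.
by case: (eqVneq j i) => // <-.
Qed.

Lemma defect_le x : `|bform s defect x x| <= k / 2 * hnegsq x.
Proof.
have pos e : `|e| = 1 -> 0 <= k / 2 * hnegsq x + e * bform s defect x x.
  move=> e1; pose B i j := k * (b i *+ (i == j)) + e * H i j.
  have -> : k / 2 * hnegsq x + e * bform s defect x x =
      bform s (fun i j => B i j / (mu i + mu j)) x x.
    rewrite (@eq_bform _ _ s defect (fun i j => H i j / (mu i + mu j)) x x x x)//;
      last exact: defectE.
    rewrite /hnegsq /wnorm -bformZ mulr_sumr.
    rewrite (eq_big_seq (fun i => (k / 2 * b i / mu i) * x i * x i)); last first.
      by move=> i _; rewrite expr2 !mulrA.
    rewrite -bform_diag// -bformD; apply: eq_bform => // i j si sj /=.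
    have i0 := mu_gt0 si; have j0 := mu_gt0 sj; rewrite /B.
    have [<-|_] := eqVneq i j; rewrite ?mulr1n ?mulr0n; field;
      by rewrite ?gt_eqF ?addr_gt0.
  apply: cauchy_bform_ge0 => [|y]; first exact: mu_gt0.
  rewrite bformD !bformZ bform_diag//.
  have -> : \sum_(i <- s) b i * y i * y i = wnorm s b y.
    by apply: eq_bigr => i _; rewrite expr2 mulrA.
  have := ler_norm (- (e * bform s H y y)).
  rewrite normrN normrM e1 mul1r => /le_trans/(_ (HG y)) h.
  have := ler_wpM2l (ltW k0) (Gb y); lra.
rewrite ler_norml; apply/andP; split.
  by have := pos 1 (normr1 _); rewrite mul1r; lra.
by have := pos (-1) (normrN1 _); rewrite mulN1r; lra.
Qed.

Lemma defect_le2 x z t : 0 < t ->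
  `|bform s defect x z| <= k / 4 * (t * hnegsq x + hnegsq z / t).
Proof.
move=> t0; pose x' i := t * x i.
have dl y y' w := @bformDl _ _ s defect y y' w.
have dr y y' w : bform s defect w (y \+ y') = bform s defect w y + bform s defect w y'.
  by rewrite !(bform_sym w) ?dl//; exact: defect_sym.
have zl a y w := @bformZl _ _ s defect a y w.
have zr a y w : bform s defect w (fun i => a * y i) = a * bform s defect w y.
  by rewrite !(bform_sym w) ?zl//; exact: defect_sym.
have P := defect_le (x' \+ z); have M := defect_le (x' \+ (fun i => -1 * z i)).
have N : hnegsq (x' \+ z) + hnegsq (x' \+ (fun i => -1 * z i)) =
    2 * (t ^+ 2 * hnegsq x + hnegsq z).
  rewrite /hnegsq /wnorm mulrDr mulrA !mulr_sumr -!big_split.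
  by apply: eq_bigr => i _ /=; rewrite /x'; ring.
rewrite !dl !dr !zl !zr (bform_sym z)// in P M; last exact: defect_sym.
have : `|t * bform s defect x z| <= k / 4 * (t ^+ 2 * hnegsq x + hnegsq z).
  move: P M N; rewrite !ler_norml => /andP[P1 P2] /andP[M1 M2] N.
  have {}N : k / 2 * hnegsq (x' \+ z) +
     k / 2 * hnegsq (x' \+ (fun i => -1 * z i)) =
     4 * (k / 4 * (t ^+ 2 * hnegsq x + hnegsq z)) by rewrite -mulrDr N; field.
  by apply/andP; split; lra.
rewrite normrM (gtr0_norm t0) mulrC -ler_pdivlMr// => /le_trans; apply.
by rewrite le_eqVlt; apply/orP; left; apply/eqP; field; rewrite gt_eqF.
Qed.

Definition lower_cst : R := 8 + 4 * (4 * k ^+ 2 + k ^+ 4 / m ^+ 2) / m ^+ 2.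

(* With [y = x - 2 g] one has [G y = - 2 K g] for the defect [K = G - b/2], and
   testing against [mu y] bounds [y] in the stronger norm [hpossq]. *)
Lemma bform_lower_bound x g :
  {in s, forall i, \sum_(j <- s) G i j * x j = b i * g i} ->
  wnorm s b x <= lower_cst * wnorm s b g.
Proof.
move=> xg; pose y i := x i + -2 * g i.
pose My i := mu i * y i.
have Gy z : bform s G z y = -2 * bform s defect z g.
  rewrite /bform mulr_sumr; apply: eq_big_seq => i si.
  rewrite (eq_bigr (fun j => z i * (G i j * x j) - 2 * z i * (G i j * g j))); last first.
    by move=> j _; rewrite /y; ring.
  rewrite sumrB -!mulr_sumr xg//.
  have -> : \sum_(j <- s) defect i j * z i * g j =
      z i * (\sum_(j <- s) G i j * g j) - z i / 2 * (b i * g i).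
    have -> : b i * g i = \sum_(j <- s) b i * g j *+ (i == j).
      rewrite (bigD1_seq i)//= eqxx big1 ?addr0// => j ji.
      by rewrite eq_sym (negbTE ji).
    rewrite !mulr_sumr -sumrB; apply: eq_bigr => j _; rewrite /defect.
    by case: eqP => _; rewrite ?mulr1n ?mulr0n; field.
  by field.
have Y : hpossq y = 2 * bform s G My y - bform s H y y.
  have E : bform s G My y = bform s G y My.
    by apply: bform_sym; exact: Gsym.
  rewrite mulr_natl mulr2n {1}E.
  have -> : bform s G y My + bform s G My y =
      bform s (fun i j => mu j * (b i *+ (i == j)) + H i j) y y.
    rewrite /bform -big_split; apply: eq_big_seq => i si; rewrite -big_split.
    by apply: eq_big_seq => j sj /=; rewrite -kG// /My; ring.
  rewrite bformD addrK (@eq_bform _ _ s _ (fun i j => mu i * b i *+ (i == j)) y y y y)//.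
    by rewrite bform_diag//; apply: eq_bigr => i _; rewrite expr2 mulrA.
  by move=> i j _ _ /=; case: eqP => [->|_]; rewrite ?mulr0.
have NMy : hnegsq My = hpossq y.
  apply: eq_big_seq => i si; rewrite /My; have i0 := mu_gt0 si.
  by field; rewrite gt_eqF.
have weak : {in s, forall i, (b i <= mu i * b i / m) /\ (b i / mu i <= b i / m)}.
  move=> i si; have i0 := mu_gt0 si; have bi := b0 si; have mi := mum si.
  split; first by rewrite ler_pdivlMr// mulrC ler_wpM2r.
  by rewrite ler_wpM2l// lef_pV2 ?posrE.
have by_le z : wnorm s b z <= hpossq z / m.
  rewrite /hpossq /wnorm mulr_suml !big_seq ler_sum// => i si.
  by have [h _] := weak _ si; have := ler_wpM2r (sqr_ge0 (z i)) h; lra.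
have neg_le z : hnegsq z <= wnorm s b z / m.
  rewrite /hnegsq /wnorm mulr_suml !big_seq ler_sum// => i si.
  by have [_ h] := weak _ si; have := ler_wpM2r (sqr_ge0 (z i)) h; lra.
have K1 := @defect_le2 My g (4 * k)^-1.
have K2 := @defect_le2 y g (m ^+ 2 / (2 * k ^+ 2)).
have Ny : hnegsq y <= hpossq y / m ^+ 2.
  rewrite expr2 invfM mulrA; apply: le_trans (neg_le y) _.
  by rewrite ler_wpM2r ?by_le ?invr_ge0 ?ltW.
rewrite !invrK invr_gt0 NMy in K1; have {}K1 := K1 ltac:(by rewrite mulr_gt0).
have t2 : 0 < m ^+ 2 / (2 * k ^+ 2) by rewrite divr_gt0 ?mulr_gt0 ?exprn_gt0.
have {}K2 := K2 t2.
set Gam := hnegsq g in K1 K2 *; set P := hpossq y in Y NMy K1 Ny *.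
have K1' : `|bform s defect My g| <= P / 16 + k ^+ 2 * Gam.
  apply: (le_trans K1); rewrite le_eqVlt; apply/orP; left; apply/eqP.
  by field; rewrite gt_eqF.
have K2' : k * `|bform s defect y g| <= P / 8 + k ^+ 4 / m ^+ 2 / 2 * Gam.
  have := ler_wpM2l (ltW k0) K2; move=> /le_trans; apply.
  have -> : k * (k / 4 * (m ^+ 2 / (2 * k ^+ 2) * hnegsq y +
      Gam / (m ^+ 2 / (2 * k ^+ 2)))) =
      m ^+ 2 / 8 * hnegsq y + k ^+ 4 / m ^+ 2 / 2 * Gam.
    by field; rewrite !gt_eqF.
  rewrite lerD2r; have m8 : 0 <= m ^+ 2 / 8 by rewrite divr_ge0// sqr_ge0.
  have := ler_wpM2l m8 Ny.
  by move=> /le_trans; apply; rewrite le_eqVlt; apply/orP; left; apply/eqP; field; rewrite gt_eqF.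
have HP := HG y.
rewrite Gy in Y; rewrite Gy in HP.
have PG : P <= 2 * (4 * k ^+ 2 + k ^+ 4 / m ^+ 2) * Gam.
  have := ler_norm (- bform s H y y); rewrite normrN.
  have := ler_norm (- bform s defect My g); rewrite normrN.
  have h := ler_norm (- bform s defect y g); rewrite normrN in h.
  have {}h := ler_wpM2l (ltW k0) h.
  by move: K1' K2' HP Y h; lra.
have xy : wnorm s b x <= 2 * wnorm s b y + 8 * wnorm s b g.
  rewrite /wnorm !mulr_sumr -big_split /= !big_seq ler_sum// => i si.
  have := mulr_ge0 (b0 si) (sqr_ge0 (x i - 4 * g i)).
  by rewrite /y; lra.
apply: (le_trans xy); rewrite /lower_cst [leRHS]mulrDl [leRHS]addrC lerD2r.
have := by_le y; rewrite -/P => h1; have h2 := neg_le g; rewrite -/Gam in h2.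
have cpos : 0 <= 2 * (4 * k ^+ 2 + k ^+ 4 / m ^+ 2).
  by rewrite mulr_ge0// addr_ge0 ?divr_ge0 ?mulr_ge0 ?exprn_ge0 ?ltW.
have h3 := le_trans PG (ler_wpM2l cpos h2).
have im0 : 0 <= m^-1 by rewrite invr_ge0 ltW.
have h4 := le_trans h1 (ler_wpM2r im0 h3).
have -> : 4 * (4 * k ^+ 2 + k ^+ 4 / m ^+ 2) / m ^+ 2 * wnorm s b g =
   2 * (2 * (4 * k ^+ 2 + k ^+ 4 / m ^+ 2) * (wnorm s b g / m) / m).
  by field; rewrite gt_eqF.
by rewrite ler_pM2l.
Qed.

End Lyapunov.

(** * Measurability in the plane and for arc length *)

Section PlaneMeasurability.
Context {R : realType}.

Lemma open_measurable_plane (A : set (plane R)) : open A -> measurable A.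
Proof.
move=> oA.
pose F (q : rat * rat * rat) : set (plane R) :=
  ball (ratr q.1.1 : R) (ratr q.2) `*` ball (ratr q.1.2 : R) (ratr q.2).
pose G q := if `[< F q `<=` A >] then F q else set0.
have -> : A = \bigcup_q G q; last first.
  apply: countable_bigcupT_measurable => [|q]; first exact: countableP.
  rewrite /G; case: ifP => // _; apply: measurableX;
    exact: measurable_realfun.measurable_ball.
apply/seteqP; split => [x Ax|x [q _]]; last first.
  by rewrite /G; case: ifPn => // /asboolP; apply.
have /nbhs_ballP[e /= e0 eA] : nbhs x A by exact: open_nbhs_nbhs.
have [r] := rat_in_itvoo (divr_gt0 e0 (ltr0Sn R 1)); rewrite in_itv/= => /andP[r0 re].
have near_rat (t : R) : exists q : rat, `|ratr q - t| < ratr r.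
  have [q] := rat_in_itvoo (ltr_pwDr r0 (lexx t)); rewrite in_itv/= => /andP[tq qt].
  by exists q; rewrite ger0_norm; lra.
have [q1 h1] := near_rat x.1; have [q2 h2] := near_rat x.2.
exists (q1, q2, r) => //; rewrite /G; case: ifPn => [_|/asboolP[]].
  by split.
move=> y [/= y1 y2]; apply: eA; rewrite /ball/= /ball/= in y1 y2 *.
have half : ratr r + ratr r <= e by lra.
by split; apply: lt_le_trans half; rewrite distrC;
  [apply: le_lt_trans (ler_distD (ratr q1) _ _) _
  |apply: le_lt_trans (ler_distD (ratr q2) _ _) _]; rewrite ltrD// distrC.
Qed.

Lemma continuous_measurable_gen d (T : measurableType d) (f : T -> R)
    (D : set T) : (forall U : set R, open U -> measurable (f @^-1` U)) ->
  measurable_fun D f.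
Proof.
move=> fU; apply: measurable_funTS.
apply: (@measurability _ _ T R setT f _ (RGenOpens.measurableE R)).
by move=> _ [_ [a [b ->]] <-]; rewrite setTI; apply: fU; exact: interval_open.
Qed.

Lemma continuous_measurable_plane (D : set (plane R)) (f : plane R -> R) :
  continuous f -> measurable_fun D f.
Proof.
move=> /continuousP cf; apply: continuous_measurable_gen => U /cf.
exact: open_measurable_plane.
Qed.

Lemma ge0_nneseries_le (u : (\bar R)^nat) (c : \bar R) :
  (forall n, (0 <= u n)%E) -> (forall n, (\sum_(0 <= i < n) u i <= c)%E) ->
  (\sum_(i <oo) u i <= c)%E.
Proof.
move=> u0 uc; apply: lime_le; first by apply: is_cvg_nneseries.
by near=> n; exact: uc.
Unshelve. all: by end_near. Qed.

(* The telescoping at the heart of the Caratheodory criterion: with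
   [a k = mu (X `&` A k)], separation bounds [mu (X `&` (A k.+2 `\` A k.+1))] by
   [a k.+2 - a k]. *)
Lemma separated_bigcup_caratheodory T (mu : {outer_measure set T -> \bar R})
    (A : (set T)^nat) :
  (forall n, A n `<=` A n.+1) ->
  (forall n X Y, X `<=` A n -> Y `<=` ~` A n.+1 ->
    (mu X + mu Y <= mu (X `|` Y))%E) ->
  mu.-caratheodory (\bigcup_n A n).
Proof.
move=> Anon sep; apply: le_caratheodory_measurable => X.
set U := \bigcup_n A n.
have [->|Xoo] := eqVneq (mu X) +oo%E; first exact: leey.
have Xfin : mu X \is a fin_num.
  by rewrite ge0_fin_numE ?outer_measure_ge0// lt_neqAle Xoo leey.
have fin Y : Y `<=` X -> mu Y \is a fin_num.
  move=> YX; rewrite ge0_fin_numE ?outer_measure_ge0//.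
  apply: (@le_lt_trans _ _ (mu X)); first exact: le_outer_measure.
  by rewrite -ge0_fin_numE ?outer_measure_ge0.
have [a aE] : exists a : nat -> R, forall k, mu (X `&` A k) = (a k)%:E.
  by exists (fun k => fine (mu (X `&` A k))) => k; rewrite fineK// fin.
have ex Y : Y `<=` X -> exists r, mu Y = r%:E.
  by move=> YX; exists (fine (mu Y)); rewrite fineK// fin.
have aU k : (mu (X `&` A k) + mu (X `&` ~` U) <= mu X)%E.
  apply: (@le_trans _ _ (mu ((X `&` A k) `|` (X `&` ~` U)))); last first.
    by apply: le_outer_measure => x [[]|[]].
  apply: (sep k) => [x []//|x [_ nU] Ax]; apply: nU.
  by exists k.+1.
have [b bE] := ex (X `&` ~` U) (@subIsetl _ _ _).
have [c cE] := ex X (@subset_refl _ _).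
have [u uE] := ex (X `&` U) (@subIsetl _ _ _).
have ac k : a k + b <= c by have := aU k; rewrite aE bE cE lee_fin.
have amon k : a k <= a k.+1.
  rewrite -lee_fin -!aE; apply: le_outer_measure => x [Xx /Anon]//.
have step k : (mu (X `&` (A k.+2 `\` A k.+1)) <= (a k.+2 - a k)%:E)%E.
  have [d dE] := ex (X `&` (A k.+2 `\` A k.+1)) (@subIsetl _ _ _).
  rewrite dE lee_fin lerBrDl -lee_fin EFinD -dE -!aE.
  apply: le_trans (sep k _ _ _ _) _; [by move=> x []|by move=> x [_ []]|].
  by apply: le_outer_measure => x [[Xx /Anon/Anon]|[Xx []]].
pose L := sup (range a).
have supa : has_sup (range a).
  by split; [exists (a 0%N), 0%N|exists (c - b) => _ [k _ <-]; rewrite lerBrDr ac].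
have L_ge k : a k <= L.
  by apply: sup_upper_bound => //; exists k.
have L_le : L <= c - b.
  by apply: ge_sup => [|_ [j _ <-]]; [exists (a 0%N), 0%N|rewrite lerBrDr ac].
have L_adh e : 0 < e -> exists k, L - e < a k.
  by move=> e0; have [_ [k _ <-]] := sup_adherent e0 supa; exists k.
clear supa; clearbody L.
have ub n : u <= 2 * L - a n.
  have -> : 2 * L - a n = a n.+1 + (2 * L - a n - a n.+1) by clear bE cE uE aU Xoo Xfin; lra.
  rewrite -lee_fin -uE EFinD -aE.
  apply: (@le_trans _ _ (mu ((X `&` A n.+1) `|`
      \bigcup_k (X `&` (A (n + k).+2%N `\` A (n + k).+1%N))))).
    apply: le_outer_measure => x [Xx [N _ AN]].
    have [nA|nA] := pselect (A n.+1 x); [by left|right].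
    have [k Ak kmin] : exists2 k, A (n + k).+2%N x & ~ A (n + k).+1%N x.
      have : A (n.+1 + N)%N x.
        have AM m : A (m + N)%N x.
          by elim: m => [//|m IHm]; rewrite addSn; exact: Anon.
        exact: AM.
      elim: N {AN} => [|N IHN]; first by rewrite addn0.
      have [/IHN//|nAN] := pselect (A (n.+1 + N)%N x); rewrite addnS addSn.
      by exists N => //; rewrite -addSn.
    by exists k.
  apply: le_trans (outer_measureU2 _ _ _) _; apply: leeD => //.
  apply: le_trans (outer_measure_sigma_subadditive mu _) _.
  apply: ge0_nneseries_le => [k|N]; first exact: outer_measure_ge0.
  apply: (@le_trans _ _ ((a (n + N).+1%N + a (n + N)%N - a n - a n.+1)%:E)).
    elim: N => [|N IHN].
      by rewrite big_nil addn0 lee_fin; clear bE cE uE aU Xoo Xfin; lra.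
    rewrite big_nat_recr//=; apply: le_trans (leeD IHN (step _)) _.
    by rewrite -EFinD lee_fin addnS; clear bE cE uE aU Xoo Xfin; lra.
  rewrite lee_fin; have := L_ge (n + N)%N; have := L_ge (n + N).+1%N.
  clear bE cE uE aU Xoo Xfin; lra.
suff uL : u <= L.
  by rewrite uE bE cE lee_fin -lerBrDr (le_trans uL).
apply/ler_addgt0Pr => e /L_adh[k hk]; have := ub k.
by clear -hk; lra.
Qed.
End PlaneMeasurability.

Section ArclengthMeasurability.
Context {R : realType}.
Implicit Types X Y A : set (plane R).

Lemma norm_le_enorm (v : plane R) : `|v| <= enorm v.
Proof.
have sq (a b : R) : `|a| <= Num.sqrt (a * a + b * b).
  by rewrite -sqrtr_sqr ler_wsqrtr// expr2 lerDl -expr2 sqr_ge0.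
rewrite prod_normE ge_max /enorm /dotp; apply/andP; split; first exact: sq.
by rewrite addrC.
Qed.

Lemma diam_ge (F : set (plane R)) x y : F x -> F y ->
  ((enorm (x - y))%:E <= diam F)%E.
Proof. by move=> Fx Fy; apply: ereal_sup_ubound; right; exists (x, y). Qed.

Lemma mu_ext_gauge_separated d (e : R) X Y : 0 < d -> d < e ->
  (forall x y, X x -> Y y -> e <= `|x - y|) ->
  (mu_ext (gauge d) X + mu_ext (gauge d) Y <= mu_ext (gauge d) (X `|` Y))%E.
Proof.
move=> d0 de sep; apply: le_ereal_inf_tmp => _ [F [mF XYF] <-].
pose part Z k := if `[< exists2 x, Z x & F k x >] then F k else set0.
have cov Z : Z `<=` X `|` Y -> measurable_cover Z (part Z).
  move=> ZXY; split => [k|z Zz].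
    by rewrite /part; case: ifP => _ //; exact: mF.
  have [k _ Fkz] := XYF _ (ZXY _ Zz); exists k => //.
  by rewrite /part; case: ifPn => // /asboolP[]; exists z.
have le_part Z : Z `<=` X `|` Y ->
    (mu_ext (gauge d) Z <= \sum_(k <oo) gauge d (part Z k))%E.
  by move=> /cov covZ; apply: ereal_inf_lbound; exists (part Z).
apply: le_trans (leeD (le_part X (@subsetUl _ _ _)) (le_part Y (@subsetUr _ _ _))) _.
rewrite -nneseriesD; try by move=> *; exact: gauge_ge0.
apply: lee_nneseries => [k _ _|k _]; first by rewrite adde_ge0// gauge_ge0.
rewrite /part; case: ifPn => [/asboolP[x Xx Fx]|_]; last first.
  by rewrite gauge0// add0e; case: ifP => // _; rewrite gauge0// gauge_ge0.
case: ifPn => [/asboolP[y Yy Fy]|_]; last by rewrite gauge0// adde0.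
have /lt_geF dF : (d%:E < diam (F k))%E.
  apply: lt_le_trans (diam_ge Fx Fy); rewrite lte_fin (lt_le_trans de)//.
  by rewrite (le_trans (sep _ _ Xx Yy))// norm_le_enorm.
by rewrite [leRHS]/gauge dF leey.
Qed.

Lemma le_mu_ext_gauge d d' X : d <= d' ->
  (mu_ext (gauge d') X <= mu_ext (gauge d) X)%E.
Proof.
move=> dd; apply: le_ereal_inf_tmp => _ [F [mF XF] <-].
apply: (@le_trans _ _ (\sum_(k <oo) gauge d' (F k))%E).
  by apply: ereal_inf_lbound; exists F.
apply: lee_nneseries => [k _ _|k _]; first exact: gauge_ge0.
rewrite /gauge; case: ifPn => [_|Fd]; case: ifPn => // Fd'; first by rewrite leey.
by move: Fd; rewrite (le_trans Fd')// lee_fin.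
Qed.

Lemma hausdorff1_separated (e : R) X Y : 0 < e ->
  (forall x y, X x -> Y y -> e <= `|x - y|) ->
  (hausdorff1 X + hausdorff1 Y <= hausdorff1 (X `|` Y))%E.
Proof.
move=> e0 sep; set Z := hausdorff1 (X `|` Y).
have [->|Zoo] := eqVneq Z +oo%E; first exact: leey.
have fin W : W `<=` X `|` Y -> hausdorff1 W \is a fin_num.
  move=> /le_hausdorff1 WZ; rewrite ge0_fin_numE ?hausdorff1_ge0//.
  by apply: le_lt_trans WZ _; rewrite lt_neqAle Zoo leey.
have muZ d d' : 0 < d -> 0 < d' ->
    (mu_ext (gauge d) X + mu_ext (gauge d') Y <= Z)%E.
  move=> d0 d'0; pose r := Num.min (Num.min d d') (e / 2).
  have r0 : 0 < r by rewrite !lt_min d0 d'0 divr_gt0.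
  have re : r < e by rewrite gt_min; apply/orP; right; lra.
  apply: (@le_trans _ _ (mu_ext (gauge r) X + mu_ext (gauge r) Y)%E).
    by apply: leeD; apply: le_mu_ext_gauge; rewrite !ge_min lexx ?orbT.
  apply: le_trans (mu_ext_gauge_separated r0 re sep) _.
  by apply: ereal_sup_ubound; exists r.
rewrite -leeBrDr ?fin//; apply: ge_ereal_sup => _ [d d0 <-].
have muX : mu_ext (gauge d) X \is a fin_num.
  rewrite ge0_fin_numE; last by apply: mu_ext_ge0 => W; exact: gauge_ge0.
  apply: (@le_lt_trans _ _ (hausdorff1 X)).
    by apply: ereal_sup_ubound; exists d.
  by rewrite -ge0_fin_numE ?hausdorff1_ge0// fin.
rewrite leeBrDr ?fin// addeC -leeBrDr//; apply: ge_ereal_sup => _ [d' d'0 <-].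
by rewrite leeBrDr// addeC; exact: muZ.
Qed.

Lemma open_measurable_hplane A : open A -> measurable (A : set (hplane R)).
Proof.
move=> oA; pose B n := [set x | ball x n.+1%:R^-1 `<=` A].
have -> : A = \bigcup_n B n.
  apply/seteqP; split => [x Ax|x [n _]]; last by apply; exact: ballxx.
  have /nbhs_ballP[e /= e0 eA] : nbhs x A by exact: open_nbhs_nbhs.
  have [n ne] : exists n, n.+1%:R^-1 < e.
    by have [n _ /= h] := near_infty_natSinv_lt (PosNum e0); exists n; exact: (h n (leqnn n)).
  by exists n => //; apply: subset_trans eA; apply: le_ball; exact: ltW.
have anti n : (n.+2%:R^-1 : R) < n.+1%:R^-1 by rewrite ltf_pV2 ?posrE ?ltr_nat.
apply: (@separated_bigcup_caratheodory _ _ (@hausdorff1_outer R)) => [n x|n X Y XB YB].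
  by apply: subset_trans; apply: le_ball; exact/ltW/anti.
apply: (@hausdorff1_separated (n.+1%:R^-1 - n.+2%:R^-1)); first by rewrite subr_gt0.
move=> x y /XB Bx /YB nBy; rewrite leNgt; apply/negP => xy; apply: nBy => z yz.
apply: Bx; move: xy yz; rewrite -!ball_normE /= => xy yz.
rewrite -(subrK y x) -addrA (le_lt_trans (ler_normD _ _))//.
by rewrite -ltrBrDr (lt_le_trans xy)// lerD2l lerN2 ltW.
Qed.

Lemma continuous_measurable_hplane (D : set (hplane R)) (f : plane R -> R) :
  continuous f -> measurable_fun D (f : hplane R -> R).
Proof.
move=> /continuousP cf; apply: continuous_measurable_gen => U /cf.
exact: open_measurable_hplane.
Qed.

End ArclengthMeasurability.

(** * Functions of class C1 *)

Section C1Functions.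
Context {R : realType}.
Implicit Types f g : plane R -> R.

Lemma is_derive_line1 f (x : plane R) (t : R) : derivable f (t, x.2) (1, 0) ->
  is_derive t 1 (fun u => f (u, x.2)) (pd1 f (t, x.2)).
Proof.
have E : (fun h : R => h^-1 *: ((f \o shift (t, x.2)) (h *: (1, 0)) - f (t, x.2))) =
   (fun h : R => h^-1 *: (((fun u => f (u, x.2)) \o shift t) (h *: 1) - f (t, x.2))).
  by apply/funext => h /=; congr (_ *: (f _ - _)); congr pair; rewrite /= scaler0 add0r.
by move=> df; split; rewrite /derivable /pd1 /derive -E.
Qed.

Lemma is_derive_line2 f (x : plane R) (t : R) : derivable f (x.1, t) (0, 1) ->
  is_derive t 1 (fun u => f (x.1, u)) (pd2 f (x.1, t)).
Proof.
have E : (fun h : R => h^-1 *: ((f \o shift (x.1, t)) (h *: (0, 1)) - f (x.1, t))) =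
   (fun h : R => h^-1 *: (((fun u => f (x.1, u)) \o shift t) (h *: 1) - f (x.1, t))).
  by apply/funext => h /=; congr (_ *: (f _ - _)); congr pair; rewrite /= scaler0 add0r.
by move=> df; split; rewrite /derivable /pd2 /derive -E.
Qed.

Lemma derive_bound_lipschitz (g dg : R -> R) (M a b : R) :
  (forall t : R, is_derive t 1 g (dg t)) ->
  (forall t, `|t - a| <= `|b - a| -> `|dg t| <= M) ->
  `|g b - g a| <= M * `|b - a|.
Proof.
move=> gd dgM.
have mvt u v : u <= v -> exists2 c, c \in `[u, v] & g v - g u = dg c * (v - u).
  move=> uv; apply: MVT_segment => //.
  apply: continuous_subspaceT => t; apply: differentiable_continuous.
  by apply/derivable1_diffP; have [] := gd t.
have [ab|ba] := leP a b.
  have [c] := mvt _ _ ab; rewrite in_itv/= => /andP[ac cb] ->.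
  by rewrite normrM ler_wpM2r// dgM// !ger0_norm ?subr_ge0// lerD2r.
have [c] := mvt _ _ (ltW ba); rewrite in_itv/= => /andP[bc ca] gE.
rewrite distrC gE normrM (distrC b a) ler_wpM2r// dgM// ler0_norm ?subr_le0//.
by rewrite ler0_norm ?subr_le0 ?(ltW ba)// lerN2 lerD2r.
Qed.

Lemma C1_continuous f : C1 f -> continuous f.
Proof.
move=> [d1 d2 c1 c2] x.
have [M [M0 M1 M2]] : exists M : R,
    [/\ 0 < M, `|pd1 f x| + 1 <= M & `|pd2 f x| + 1 <= M].
  exists (`|pd1 f x| + `|pd2 f x| + 1).
  by split; [rewrite ltr_wpDl ?addr_ge0|rewrite lerD2r lerDl|rewrite lerD2r lerDr].
have near_bd (h : plane R -> R) : continuous h -> `|h x| + 1 <= M ->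
    \forall y \near x, `|h y| <= M.
  move=> ch hM; have : (`|h x| + 1) > `|h x| by rewrite ltrDl.
  have cn : {for x, continuous (fun y => `|h y|)}.
    by apply: continuous_comp; [exact: ch|exact: norm_continuous].
  move=> /(cvgr_lt _ cn); apply: filterS => y /ltW/le_trans; exact.
have b1 : \forall y \near x, `|pd1 f y| <= M.
  exact: near_bd.
have b2 : \forall y \near x, `|pd2 f y| <= M.
  exact: near_bd.
have /nbhs_ballP[r /= r0 rM] : nbhs x [set y | `|pd1 f y| <= M /\ `|pd2 f y| <= M].
  exact: filterI b1 b2.
apply/cvgrPdist_lt => e e0.
have d0 : 0 < Num.min r (e / (2 * M)).
  by rewrite lt_min r0 divr_gt0// mulr_gt0.
suff : nbhs x [set y | `|f x - f y| < e] by [].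
apply/nbhs_ballP; exists (Num.min r (e / (2 * M))) => //= y [/= y1 y2].
rewrite /ball/= !lt_min in y1 y2.
have /andP[y1r y1e] := y1; have /andP[y2r y2e] := y2.
have -> : f x - f y = (f (x.1, x.2) - f (x.1, y.2)) + (f (x.1, y.2) - f (y.1, y.2)).
  by rewrite -!surjective_pairing addrA subrK.
have h2 : `|f (x.1, x.2) - f (x.1, y.2)| <= M * `|x.2 - y.2|.
  rewrite distrC [`|x.2 - _|]distrC.
  apply: (@derive_bound_lipschitz (fun u => f (x.1, u)) (fun t => pd2 f (x.1, t))).
    by move=> t; apply: is_derive_line2.
  move=> t ht; apply: (rM (x.1, t) _).2; split => /=; first exact: ballxx.
  by rewrite /ball/= distrC (le_lt_trans ht)// distrC.
have h1 : `|f (x.1, y.2) - f (y.1, y.2)| <= M * `|x.1 - y.1|.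
  rewrite distrC [`|x.1 - _|]distrC.
  apply: (@derive_bound_lipschitz (fun u => f (u, y.2)) (fun t => pd1 f (t, y.2))).
    by move=> t; apply: is_derive_line1.
  move=> t ht; apply: (rM (t, y.2) _).1; split => //=.
  by rewrite /ball/= distrC (le_lt_trans ht)// distrC.
have MM : M * (e / (2 * M)) = e / 2 by field; rewrite gt_eqF.
rewrite (le_lt_trans (ler_normD _ _))//.
have := ltr_pM2l M0 `|x.1 - y.1| (e / (2 * M)); have := ltr_pM2l M0 `|x.2 - y.2| (e / (2 * M)).
by rewrite y1e y2e MM => k2 k1; rewrite (splitr e) ltrD// ?(le_lt_trans h1)// (le_lt_trans h2).
Qed.

Lemma pd1_lin f g (a : R) x : derivable f x (1, 0) -> derivable g x (1, 0) ->
  derivable (a *: f + g) x (1, 0) /\ pd1 (a *: f + g) x = a * pd1 f x + pd1 g x.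
Proof.
move=> df dg; have daf := derivableZ (k := a) df.
split; first exact: derivableD daf dg.
by rewrite /pd1 (deriveD daf dg) (deriveZ _ df).
Qed.

Lemma pd2_lin f g (a : R) x : derivable f x (0, 1) -> derivable g x (0, 1) ->
  derivable (a *: f + g) x (0, 1) /\ pd2 (a *: f + g) x = a * pd2 f x + pd2 g x.
Proof.
move=> df dg; have daf := derivableZ (k := a) df.
split; first exact: derivableD daf dg.
by rewrite /pd2 (deriveD daf dg) (deriveZ _ df).
Qed.

Lemma C1_lin f g (a : R) : C1 f -> C1 g -> C1 (a *: f + g).
Proof.
move=> [f1 f2 cf1 cf2] [g1 g2 cg1 cg2]; split => [x|x||].
- exact: (pd1_lin _ _ _).1.
- exact: (pd2_lin _ _ _).1.
- have -> : pd1 (a *: f + g) = fun x => a * pd1 f x + pd1 g x.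
    by apply/funext => x; rewrite (pd1_lin _ (f1 x) (g1 x)).2.
  move=> x; apply: cvgD; last exact: cg1.
  by apply: cvgM; [exact: cvg_cst|exact: cf1].
- have -> : pd2 (a *: f + g) = fun x => a * pd2 f x + pd2 g x.
    by apply/funext => x; rewrite (pd2_lin _ (f2 x) (g2 x)).2.
  move=> x; apply: cvgD; last exact: cg2.
  by apply: cvgM; [exact: cvg_cst|exact: cf2].
Qed.

End C1Functions.

(** * Square integrable functions *)

Section SquareIntegrable.
Context d (T : measurableType d) {R : realType} (mu : {measure set T -> \bar R}).
Variables (D : set T) (mD : measurable D).
Implicit Types f g w : T -> R.

Definition sqint f := measurable_fun D f /\
  mu.-integrable D (EFin \o (fun x => f x ^+ 2)).

Lemma ae_le_integrable f g : measurable_fun D f ->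
  mu.-integrable D (EFin \o g) -> {ae mu, forall x, D x -> `|f x| <= g x} ->
  mu.-integrable D (EFin \o f).
Proof.
move=> mf ig fg; apply/integrableP; split; first exact/measurable_EFinP.
have /integrableP[mg ioo] := ig; apply: le_lt_trans ioo.
apply: ae_ge0_le_integral => //.
- by apply: measurableT_comp => //; exact/measurable_EFinP.
- exact: measurableT_comp.
- apply: filterS fg => x h Dx /=; rewrite lee_fin (le_trans (h Dx))//.
  exact: ler_norm.
Qed.

Lemma ae_eq_Rintegral f g : measurable_fun D f -> measurable_fun D g ->
  {ae mu, forall x, D x -> f x = g x} ->
  \int[mu]_(x in D) f x = \int[mu]_(x in D) g x.
Proof.
move=> mf mg fg; congr fine; apply: ae_eq_integral => //.
- exact/measurable_EFinP.
- exact/measurable_EFinP.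
- by apply: filterS fg => x h Dx; rewrite h.
Qed.

Lemma ae_le_Rintegral f g : mu.-integrable D (EFin \o f) ->
  mu.-integrable D (EFin \o g) -> {ae mu, forall x, D x -> f x <= g x} ->
  \int[mu]_(x in D) f x <= \int[mu]_(x in D) g x.
Proof.
move=> fi gi fg.
have mf : measurable_fun D f by apply/measurable_EFinP; exact: measurable_int fi.
have mg : measurable_fun D g by apply/measurable_EFinP; exact: measurable_int gi.
have mM : measurable_fun D (fun x => Num.max (f x) (g x)) by exact: measurable_maxr.
have eqg : {ae mu, forall x, D x -> g x = Num.max (f x) (g x)}.
  by apply: filterS fg => x h Dx; rewrite max_r// h.
rewrite (ae_eq_Rintegral mg mM eqg); apply: le_Rintegral => //.
  apply: (@ae_le_integrable _ (fun x => `|g x|)) => //.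
    exact: integrable_norm.
  by apply: filterS eqg => x h Dx; rewrite -h.
by move=> x _; rewrite le_max lexx.
Qed.

Lemma norm_mul_le_sqrD (u v : R) : `|u * v| <= u ^+ 2 + v ^+ 2.
Proof.
have h := sqr_ge0 (u + v); have h' := sqr_ge0 (u - v).
have := sqr_ge0 u; have := sqr_ge0 v.
by rewrite ler_norml => hv hu; apply/andP; split; lra.
Qed.

Lemma sqint_mul f g : sqint f -> sqint g ->
  mu.-integrable D (EFin \o (fun x => f x * g x)).
Proof.
move=> [mf fi] [mg gi]; have i2 := integrableD mD fi gi.
apply: (le_integrable mD _ _ i2).
  by apply/measurable_EFinP; exact: measurable_funM.
move=> x _ /=; rewrite lee_fin [leRHS]ger0_norm ?addr_ge0 ?sqr_ge0//.
exact: norm_mul_le_sqrD.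
Qed.

Lemma sqint_lin f g (a : R) : sqint f -> sqint g -> sqint (fun x => a * f x + g x).
Proof.
move=> fi gi; have [mf f2] := fi; have [mg g2] := gi.
have m : measurable_fun D (fun x => a * f x + g x).
  by apply: measurable_funD => //; exact: measurable_funM.
split=> //; have fg := sqint_mul fi gi.
have i := integrableD mD (integrableD mD (integrableZl mD (a ^+ 2) f2)
  (integrableZl mD (2 * a) fg)) g2.
apply: eq_integrable i => // x _ /=.
by rewrite -!EFinM -!EFinD; congr EFin; ring.
Qed.

Lemma sqint_bounded_mul w (M : R) f g : measurable_fun D w ->
  {ae mu, forall x, D x -> `|w x| <= M} -> sqint f -> sqint g ->
  mu.-integrable D (EFin \o (fun x => w x * f x * g x)).
Proof.
move=> mw wM fi gi; have fg := sqint_mul fi gi.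
have := integrableZl mD M (integrable_norm fg) => i.
apply: (@ae_le_integrable _ (fun x => M * `|f x * g x|)) => //.
  by have [mf _] := fi; have [mg _] := gi; apply: measurable_funM => //; exact: measurable_funM.
by apply: filterS wM => x h Dx; rewrite -mulrA normrM ler_wpM2r// h.
Qed.

Lemma sqdist_lin_cvg0 (w w' : (T -> R)^nat) f f' (a : R) :
  (forall n, measurable_fun D (w n)) -> (forall n, measurable_fun D (w' n)) ->
  measurable_fun D f -> measurable_fun D f' ->
  (fun n => \int[mu]_(x in D) (((w n x - f x) ^+ 2)%:E))%E @ \oo --> 0%E ->
  (fun n => \int[mu]_(x in D) (((w' n x - f' x) ^+ 2)%:E))%E @ \oo --> 0%E ->
  (fun n => \int[mu]_(x in D)
    ((((a * w n x + w' n x) - (a * f x + f' x)) ^+ 2)%:E))%E @ \oo --> 0%E.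
Proof.
move=> mw mw' mf mf' cw cw'.
have mE (u v : T -> R) : measurable_fun D u -> measurable_fun D v ->
    measurable_fun D (fun x => ((u x - v x) ^+ 2)%:E).
  by move=> mu' mv; apply/measurable_EFinP; apply: measurable_funX; exact: measurable_funB.
have ub : (fun n => (2 * a ^+ 2)%:E * \int[mu]_(x in D) (((w n x - f x) ^+ 2)%:E) +
    2%:E * \int[mu]_(x in D) (((w' n x - f' x) ^+ 2)%:E))%E @ \oo --> 0%E.
  rewrite -[X in _ --> X]adde0; apply: cvgeD => //.
    by rewrite -[X in _ --> X](mule0 (2 * a ^+ 2)%:E); apply: cvgeZl.
  by rewrite -[X in _ --> X](mule0 2%:E); apply: cvgeZl.
apply: (squeeze_cvge _ (cvg_cst 0%E) ub); apply: nearW => n; apply/andP; split.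
  by apply: integral_ge0 => x _; rewrite lee_fin sqr_ge0.
rewrite -!ge0_integralZl//; try exact: mE; try by move=> *; rewrite lee_fin sqr_ge0.
2: by rewrite lee_fin mulr_ge0 ?sqr_ge0.
rewrite -ge0_integralD//; last first.
- by apply/measurable_funeM; exact: mE.
- by move=> x _; apply: mule_ge0; rewrite lee_fin ?sqr_ge0.
- by apply/measurable_funeM; exact: mE.
- by move=> x _; apply: mule_ge0; rewrite lee_fin ?sqr_ge0// mulr_ge0 ?sqr_ge0.
apply: ge0_le_integral => //.
- by move=> x _; rewrite lee_fin sqr_ge0.
- by apply: mE; apply: measurable_funD => //; apply: measurable_funM.
- by apply: emeasurable_funD; apply/measurable_funeM; exact: mE.
move=> x _; rewrite -!EFinM -EFinD lee_fin.
have := sqr_ge0 (a * (w n x - f x) - (w' n x - f' x)).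
by set p := w n x; set q := w' n x; lra.
Qed.

Lemma sqint_mul_lin f g h (a : R) : sqint f -> sqint g -> sqint h ->
  \int[mu]_(x in D) ((a * f x + g x) * h x) =
  a * (\int[mu]_(x in D) (f x * h x)) + \int[mu]_(x in D) (g x * h x).
Proof.
move=> f2 g2 h2; have fh := sqint_mul f2 h2; have gh := sqint_mul g2 h2.
rewrite -RintegralZl// -RintegralD//; last exact: (integrableZl mD a fh).
by apply: eq_Rintegral => x _; rewrite mulrDl mulrA.
Qed.

End SquareIntegrable.

Section AlmostEverywhere.
Context d (T : measurableType d) {R : realType} (mu : {measure set T -> \bar R}).
Implicit Types P Q S : T -> Prop.

Lemma ae_imp P Q : {ae mu, forall x, P x} -> (forall x, P x -> Q x) ->
  {ae mu, forall x, Q x}.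
Proof. by move=> aP PQ; apply: filterS aP => x; exact: PQ. Qed.

Lemma ae_imp2 P Q S : {ae mu, forall x, P x} -> {ae mu, forall x, Q x} ->
  (forall x, P x -> Q x -> S x) -> {ae mu, forall x, S x}.
Proof. by move=> aP aQ PQS; move: aP aQ; apply: filterS2 => x; exact: PQS. Qed.

End AlmostEverywhere.

Section WeightedForm.
Context d (T : measurableType d) {R : realType} (mu : {measure set T -> \bar R}).
Variables (D : set T) (mD : measurable D) (w : T -> R) (M : R).
Hypotheses (mw : measurable_fun D w)
  (wM : {ae mu, forall x, D x -> `|w x| <= M}).
Implicit Types f g h : T -> R.

Lemma weighted_lin f g h (a : R) : sqint mu D f -> sqint mu D g ->
  sqint mu D h ->
  \int[mu]_(x in D) (w x * (a * f x + g x) * h x) =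
  a * (\int[mu]_(x in D) (w x * f x * h x)) + \int[mu]_(x in D) (w x * g x * h x).
Proof.
move=> f2 g2 h2; have fh := sqint_bounded_mul mD mw wM f2 h2.
have gh := sqint_bounded_mul mD mw wM g2 h2.
rewrite -RintegralZl// -RintegralD//; last exact: (integrableZl mD a fh).
by apply: eq_Rintegral => x _; ring.
Qed.

Lemma weighted_ge0 f : {ae mu, forall x, D x -> 0 <= w x} -> sqint mu D f ->
  0 <= \int[mu]_(x in D) (w x * f x * f x).
Proof.
move=> w0 f2; have <- : \int[mu]_(x in D) 0 = 0 :> R.
  by rewrite /Rintegral integral0.
apply: ae_le_Rintegral => //; first exact: integrable0.
  exact: (sqint_bounded_mul mD mw wM f2 f2).
by apply: filterS w0 => x h /h {}h; rewrite -mulrA mulr_ge0// -expr2 sqr_ge0.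
Qed.

Lemma weighted_grad_integrable f f' g g' : sqint mu D f -> sqint mu D f' ->
  sqint mu D g -> sqint mu D g' ->
  mu.-integrable D (EFin \o (fun x => w x * (f x * f' x + g x * g' x))).
Proof.
move=> f2 f2' g2 g2'; have i := integrableD mD
  (sqint_bounded_mul mD mw wM f2 f2') (sqint_bounded_mul mD mw wM g2 g2').
by apply: eq_integrable i => // x _ /=; rewrite mulrDr !mulrA.
Qed.

Lemma weighted_gradE f f' g g' : sqint mu D f -> sqint mu D f' ->
  sqint mu D g -> sqint mu D g' ->
  \int[mu]_(x in D) (w x * (f x * f' x + g x * g' x)) =
  \int[mu]_(x in D) (w x * f x * f' x) + \int[mu]_(x in D) (w x * g x * g' x).
Proof.
move=> f2 f2' g2 g2'; rewrite -RintegralD//; try exact: (sqint_bounded_mul mD mw wM).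
by apply: eq_Rintegral => x _; rewrite mulrDr !mulrA.
Qed.

Lemma weighted_norm_le (v : T -> R) (N k : R) f : measurable_fun D v ->
  {ae mu, forall x, D x -> `|v x| <= N} ->
  {ae mu, forall x, D x -> `|w x| <= k * v x} -> sqint mu D f ->
  `|\int[mu]_(x in D) (w x * f x * f x)| <=
  k * \int[mu]_(x in D) (v x * f x * f x).
Proof.
move=> mv vN wv f2; have iw := sqint_bounded_mul mD mw wM f2 f2.
have iv := sqint_bounded_mul mD mv vN f2 f2.
rewrite -RintegralZl//; apply: le_trans (le_normr_Rintegral mD iw) _.
apply: ae_le_Rintegral => //; first exact: integrable_norm.
  exact: (integrableZl mD k iv).
apply: ae_imp wv _ => x h /h {}h; rewrite -mulrA normrM [`|f x * f x|]ger0_norm.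
  by rewrite -!mulrA mulrA ler_wpM2r// -expr2 sqr_ge0.
by rewrite -expr2 sqr_ge0.
Qed.

Lemma Rintegral_eq0 f : (forall x, D x -> f x = 0) ->
  \int[mu]_(x in D) f x = 0.
Proof.
move=> f0; rewrite (@eq_Rintegral _ _ _ mu D (fun=> 0)).
  by rewrite /Rintegral integral0.
by move=> x; rewrite inE; exact: f0.
Qed.

Lemma Rintegral_lin f g (a : R) : mu.-integrable D (EFin \o f) ->
  mu.-integrable D (EFin \o g) ->
  \int[mu]_(x in D) (a * f x + g x) =
  a * (\int[mu]_(x in D) f x) + \int[mu]_(x in D) g x.
Proof.
by move=> fi gi; rewrite -RintegralZl// -RintegralD//; exact: (integrableZl mD a fi).
Qed.

Lemma sqintS (E : set T) f : measurable E -> E `<=` D -> sqint mu D f ->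
  sqint mu E f.
Proof.
move=> mE ED [mf f2]; split; first exact: measurable_funS mf.
exact: integrableS f2.
Qed.

End WeightedForm.

Section BoundedPlaneSets.
Context {R : realType}.
Variables (O : set (plane R)) (oO : open O) (bO : bounded_set O).

Lemma measurable_bdry : measurable (bdry O : set (hplane R)).
Proof.
apply: measurableD; last by apply: open_measurable_hplane; exact: open_interior.
have := measurableC (open_measurable_hplane (closed_openC (@closed_closure _ O))).
by rewrite setCK.
Qed.

Lemma bounded_sub_square : exists M : R, O `<=` `[- M, M] `*` `[- M, M].
Proof.
have [N [_ h]] := bO; exists (N + 1) => x Ox.
have : `|x| <= N + 1 by apply: h => //; rewrite ltrDl.
by rewrite prod_normE ge_max !ler_norml => /andP[x1 x2]; split; rewrite /= in_itv.
Qed.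

Lemma leb2_bounded_lty : (leb2 O < +oo)%E.
Proof.
have [M OM] := bounded_sub_square.
have mI : measurable (`[- M, M]%classic : set R) by exact: measurable_itv.
apply: (@le_lt_trans _ _ (leb2 (`[- M, M] `*` `[- M, M]))).
  apply: le_measure => //; rewrite inE.
    exact: open_measurable_plane.
  exact: measurableX.
have -> : leb2 (`[- M, M] `*` `[- M, M]) =
    (lebesgue_measure `[(- M)%R, M] * lebesgue_measure `[(- M)%R, M])%E.
  exact: (product_measure1E lebesgue_measure lebesgue_measure mI mI).
rewrite lebesgue_measure_itv/=.
by case: ifP => _; rewrite ?mule0 ?ltry// -EFinB -EFinM ltry.
Qed.

Lemma continuous_sqint (f : plane R -> R) : continuous f -> sqint leb2 O f.
Proof.
move=> cf; have mO := open_measurable_plane oO.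
have mf : measurable_fun O f by exact: continuous_measurable_plane.
split=> //; have [M OM] := bounded_sub_square.
have cK : compact (`[- M, M] `*` `[- M, M] : set (plane R)).
  by apply: compact_setX; exact: segment_compact.
have /compact_bounded[N [_ h]] : compact (f @` (`[- M, M] `*` `[- M, M])).
  by apply: continuous_compact => //; exact: continuous_subspaceT.
have fN x : O x -> `|f x| <= N + 1.
  by move=> Ox; apply: h; [rewrite ltrDl|exists x => //; exact: OM].
refine (@measurable_bounded_integrable _ _ _ leb2 (fun x => f x ^+ 2) O mO
  leb2_bounded_lty _ _).
  exact: measurable_funX.
exists ((N + 1) ^+ 2); split; first exact: num_real.
move=> K /ltW NK x Ox; apply: le_trans NK.
rewrite normrX ler_pXn2r ?nnegrE ?fN//.
exact: le_trans (normr_ge0 _) (fN x Ox).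
Qed.

Lemma weak_gradient_lin (f g f1 f2 g1 g2 : plane R -> R) (a : R) :
  sqint leb2 O f -> sqint leb2 O f1 -> sqint leb2 O f2 ->
  sqint leb2 O g -> sqint leb2 O g1 -> sqint leb2 O g2 ->
  weak_gradient O f f1 f2 -> weak_gradient O g g1 g2 ->
  weak_gradient O (a *: f + g) (a *: f1 + g1) (a *: f2 + g2).
Proof.
move=> sf sf1 sf2 sg sg1 sg2 wf wg w tw; have [[d1 d2 c1 c2] _ _] := tw.
have mO := open_measurable_plane oO.
have sw := continuous_sqint (C1_continuous (And4 d1 d2 c1 c2)).
have s1 := continuous_sqint c1; have s2 := continuous_sqint c2.
have E (u v h : plane R -> R) : sqint leb2 O u -> sqint leb2 O v ->
    sqint leb2 O h -> \int[leb2]_(x in O) ((a *: u + v) x * h x) =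
    a * (\int[leb2]_(x in O) (u x * h x)) + \int[leb2]_(x in O) (v x * h x).
  exact: sqint_mul_lin.
have [f1E f2E] := wf w tw; have [g1E g2E] := wg w tw.
split.
  apply: etrans (E _ _ _ sf sg s1) _; rewrite f1E g1E.
  by apply: esym; apply: etrans (congr1 -%R (E _ _ _ sf1 sg1 sw)) _; rewrite opprD mulrN.
apply: etrans (E _ _ _ sf sg s2) _; rewrite f2E g2E.
by apply: esym; apply: etrans (congr1 -%R (E _ _ _ sf2 sg2 sw)) _; rewrite opprD mulrN.
Qed.

Lemma has_trace_lin (f g f1 f2 g1 g2 : plane R -> R) (t u : plane R -> R) (a : R) :
  measurable_fun O f -> measurable_fun O f1 -> measurable_fun O f2 ->
  measurable_fun O g -> measurable_fun O g1 -> measurable_fun O g2 ->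
  measurable_fun (bdry O : set (hplane R)) (t : hplane R -> R) ->
  measurable_fun (bdry O : set (hplane R)) (u : hplane R -> R) ->
  has_trace O f f1 f2 t -> has_trace O g g1 g2 u ->
  has_trace O (a *: f + g) (a *: f1 + g1) (a *: f2 + g2) (a *: t + u).
Proof.
move=> mf mf1 mf2 mg mg1 mg2 mt mu [w [Cw w0 w1 w2 wt]] [v [Cv v0 v1 v2 vt]].
have mO := open_measurable_plane oO; have mB := measurable_bdry.
exists (fun n => a *: w n + v n).
have mp (h : plane R -> R) : continuous h -> measurable_fun O h.
  exact: continuous_measurable_plane.
have pE n := Cw n; have qE n := Cv n.
have cw1 n : continuous (pd1 (w n)) by case: (Cw n).
have cv1 n : continuous (pd1 (v n)) by case: (Cv n).
have cw2 n : continuous (pd2 (w n)) by case: (Cw n) => _ _ _.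
have cv2 n : continuous (pd2 (v n)) by case: (Cv n) => _ _ _.
have p1 n : pd1 (a *: w n + v n) = (fun x => a * pd1 (w n) x + pd1 (v n) x).
  apply/funext => x; have [d _ _ _] := pE n; have [d' _ _ _] := qE n.
  by rewrite (pd1_lin a (d x) (d' x)).2.
have p2 n : pd2 (a *: w n + v n) = (fun x => a * pd2 (w n) x + pd2 (v n) x).
  apply/funext => x; have [_ d _ _] := pE n; have [_ d' _ _] := qE n.
  by rewrite (pd2_lin a (d x) (d' x)).2.
split.
- by move=> n; exact: C1_lin.
- refine (@sqdist_lin_cvg0 _ _ _ leb2 O mO w v f g a _ _ mf mg w0 v0) => n;
    by apply: mp; exact: C1_continuous.
- have cvg0 := @sqdist_lin_cvg0 _ _ _ leb2 O mO (fun n => pd1 (w n)) (fun n => pd1 (v n)) f1 g1 a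
    (fun n => mp _ (cw1 n)) (fun n => mp _ (cv1 n)) mf1 mg1 w1 v1.
  by under eq_fun do rewrite p1; exact cvg0.
- have cvg0 := @sqdist_lin_cvg0 _ _ _ leb2 O mO (fun n => pd2 (w n)) (fun n => pd2 (v n)) f2 g2 a
    (fun n => mp _ (cw2 n)) (fun n => mp _ (cv2 n)) mf2 mg2 w2 v2.
  by under eq_fun do rewrite p2; exact cvg0.
- refine (@sqdist_lin_cvg0 _ _ _ arclength (bdry O) mB w v t u a _ _ mt mu wt vt) => n;
    by apply: continuous_measurable_hplane; exact: C1_continuous.
Qed.

Lemma H1_lin (s s' : sob R) (a : R) : H1 O s -> H1 O s' -> H1 O (a *: s + s').
Proof.
move=> [sf sf1 sf2 [wf bf tf]] [sg sg1 sg2 [wg bg tg]].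
have mO := open_measurable_plane oO; have mB := measurable_bdry.
split.
- exact (@sqint_lin _ _ _ leb2 O mO _ _ a sf sg).
- exact (@sqint_lin _ _ _ leb2 O mO _ _ a sf1 sg1).
- exact (@sqint_lin _ _ _ leb2 O mO _ _ a sf2 sg2).
split.
- exact (weak_gradient_lin a sf sf1 sf2 sg sg1 sg2 wf wg).
- exact (@sqint_lin _ _ _ arclength _ mB _ _ a bf bg).
- exact (has_trace_lin a sf.1 sf1.1 sf2.1 sg.1 sg1.1 sg2.1 bf.1 bg.1 tf tg).
Qed.

End BoundedPlaneSets.

(** * The energy form *)

Section EnergyForm.
Context {R : realType} (p : problem R) (hp : admissible p).
Local Notation O := (Omega p).
Local Notation GR := (Gamma p Robin : set (hplane R)).
Implicit Types (phi psi chi : preHH R) (s w : sob R).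

Let oO : open O. Proof. by have [] := adm_domain hp. Qed.
Let bO : bounded_set O. Proof. by have [] := adm_domain hp. Qed.
Let mO : measurable O := open_measurable_plane oO.
Let mB : measurable (bdry O : set (hplane R)) := measurable_bdry O.
Let mGR : measurable GR := bp_measurable (adm_boundary hp) Robin.

Lemma V_lin s s' (a : R) : V p s -> V p s' -> V p (a *: s + s').
Proof.
move=> [hs ds ps] [hs' ds' ps']; split.
- exact (H1_lin oO bO a hs hs').
- refine (ae_imp2 ds ds' _) => x h h' Dx.
  change (a * str s x + str s' x = 0).
  by rewrite h// h'// mulr0 addr0.
- move=> k; refine (ae_imp2 (ps k) (ps' k) _) => x h h' kx.
  change (a * str s ((x : plane R) + Defs.shift k) + str s' ((x : plane R) + Defs.shift k) =
    a * str s x + str s' x).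
  by rewrite h// h'.
Qed.

Lemma HH_lin phi psi (a : R) : HH p phi -> HH p psi -> HH p (a *: phi + psi).
Proof.
move=> [u v] [u' v']; split; first exact (@sqint_lin _ _ _ leb2 O mO _ _ a u u').
exact: V_lin.
Qed.

Lemma HH0 phi : HH p phi -> HH p 0.
Proof. by move=> h; have := HH_lin (-1) h h; rewrite scaleN1r addNr. Qed.

Lemma HHZ phi (a : R) : HH p phi -> HH p (a *: phi).
Proof. by move=> h; have := HH_lin a h (HH0 h); rewrite addr0. Qed.

Lemma HHD phi psi : HH p phi -> HH p psi -> HH p (phi + psi).
Proof. by move=> h; have := HH_lin 1 h; rewrite scale1r; apply. Qed.

Lemma HHB phi psi : HH p phi -> HH p psi -> HH p (phi - psi).
Proof. by move=> h h'; have := HH_lin (-1) h' h; rewrite scaleN1r addrC. Qed.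

Lemma HH_projP phi : HH p phi -> HH p (projP phi).
Proof. by move=> h; split; [exact: h.1|exact: (HH0 h).2]. Qed.

Lemma HH_projS phi : HH p phi -> HH p (0, phi.2).
Proof. by move=> h; split; [exact: (HH0 h).1|exact: h.2]. Qed.

Let bnd f : positive_bounded p f -> exists M : R,
  {ae leb2, forall x, O x -> `|f x| <= M}.
Proof.
move=> [_ [m [M [m0 h]]]]; exists M; refine (ae_imp h _) => x {}h Ox.
by have /andP[mf fM] := h Ox; rewrite ger0_norm// (le_trans (ltW m0)).
Qed.

Let pos f : positive_bounded p f -> {ae leb2, forall x, O x -> 0 <= f x}.
Proof.
move=> [_ [m [M [m0 h]]]]; refine (ae_imp h _) => x {}h Ox.
by have /andP[mf fM] := h Ox; rewrite (le_trans (ltW m0)).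
Qed.

Let mc : measurable_fun O (cc p). Proof. by have [] := adm_c hp. Qed.
Let ms : measurable_fun O (sg p). Proof. by have [] := adm_sigma hp. Qed.
Let mh : measurable_fun O (hh p). Proof. by have [] := adm_h hp. Qed.

Lemma H1_str_sqint s : H1 O s -> sqint arclength GR (str s).
Proof.
move=> [_ _ _ [_ t2 _]].
exact (@sqintS _ _ _ arclength (bdry O) mB GR (str s) mGR (@bp_sub _ _ (adm_boundary hp) Robin) t2).
Qed.

Definition cform (f g : plane R -> R) : R :=
  \int[leb2]_(x in O) (cc p x * f x * g x).
Definition hform (f g : plane R -> R) : R :=
  \int[leb2]_(x in O) (hh p x * f x * g x).
Definition sform s w : R := \int[leb2]_(x in O) (sg p x * sdx s x * sdx w x)
  + \int[leb2]_(x in O) (sg p x * sdy s x * sdy w x).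
Definition rform s w : R := \int[arclength]_(x in GR) (aa p * str s x * str w x).

Lemma ipE phi psi : HH p phi -> HH p psi ->
  ip p phi psi = cform phi.1 psi.1 + sform phi.2 psi.2 + rform phi.2 psi.2.
Proof.
move=> [f2 [[_ fx fy _] _ _]] [g2 [[_ gx gy _] _ _]]; congr (_ + _).
have [M cM] := bnd (adm_c hp); have [N sN] := bnd (adm_sigma hp).
have E1 := @weighted_gradE _ _ _ leb2 O mO (sg p) N ms sN _ _ _ _ fx gx fy gy.
rewrite /sform -E1.
exact (@RintegralD _ _ _ leb2 O _ _ mO
  (@sqint_bounded_mul _ _ _ leb2 O mO _ M _ _ mc cM f2 g2)
  (@weighted_grad_integrable _ _ _ leb2 O mO (sg p) N ms sN _ _ _ _ fx gx fy gy)).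
Qed.

Lemma ip_sym phi psi : ip p phi psi = ip p psi phi.
Proof.
congr (_ + _).
  by refine (@eq_Rintegral _ _ _ leb2 O _ _ _) => x _; ring.
by refine (@eq_Rintegral _ _ _ arclength GR _ _ _) => x _; ring.
Qed.

Lemma cformC f g : cform f g = cform g f.
Proof. by refine (@eq_Rintegral _ _ _ leb2 O _ _ _) => x _; ring. Qed.

Lemma cform_lin f g k (a : R) : sqint leb2 O f -> sqint leb2 O g ->
  sqint leb2 O k -> cform (a *: f + g) k = a * cform f k + cform g k.
Proof.
have [M cM] := bnd (adm_c hp) => sf sg sk.
exact (@weighted_lin _ _ _ leb2 O mO _ M mc cM _ _ _ a sf sg sk).
Qed.

Lemma ip_lin phi phi' psi (a : R) : HH p phi -> HH p phi' -> HH p psi ->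
  ip p (a *: phi + phi') psi = a * ip p phi psi + ip p phi' psi.
Proof.
move=> h h' k; rewrite !ipE//; last exact: HH_lin.
have [[f2 [hf _ _]] [f2' [hf' _ _]] [g2 [hg _ _]]] := And3 h h' k.
have [[_ fx fy _] [_ fx' fy' _] [_ gx gy _]] := And3 hf hf' hg.
have [N sN] := bnd (adm_sigma hp).
have aM : {ae (@arclength R), forall x : hplane R, GR x -> `|aa p| <= `|aa p|}.
  exact: aeW.
have ec := cform_lin a f2 f2' g2.
have ex := @weighted_lin _ _ _ leb2 O mO _ N ms sN _ _ _ a fx fx' gx.
have ey := @weighted_lin _ _ _ leb2 O mO _ N ms sN _ _ _ a fy fy' gy.
have er := @weighted_lin _ _ _ arclength GR mGR (fun=> aa p) _ (measurable_cst _) aM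
  _ _ _ a (H1_str_sqint hf) (H1_str_sqint hf') (H1_str_sqint hg).
have -> : cform (a *: phi + phi').1 psi.1 = a * cform phi.1 psi.1 + cform phi'.1 psi.1.
  exact ec.
have -> : rform (a *: phi + phi').2 psi.2 = a * rform phi.2 psi.2 + rform phi'.2 psi.2.
  exact er.
have -> : sform (a *: phi + phi').2 psi.2 = a * sform phi.2 psi.2 + sform phi'.2 psi.2.
  by apply: etrans (congr2 +%R ex ey) _; rewrite /sform; ring.
by rewrite /sform; ring.
Qed.

Lemma cform_ge0 f : sqint leb2 O f -> 0 <= cform f f.
Proof.
have [M cM] := bnd (adm_c hp) => sf.
exact (@weighted_ge0 _ _ _ leb2 O mO _ M mc cM f (pos (adm_c hp)) sf).
Qed.

Lemma ip_ge0 phi : HH p phi -> 0 <= ip p phi phi.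
Proof.
move=> h; rewrite ipE//; have [f2 [hf _ _]] := h; have [_ fx fy _] := hf.
have [N sN] := bnd (adm_sigma hp); have s0 := pos (adm_sigma hp).
apply: addr_ge0; [apply: addr_ge0; [exact: cform_ge0|apply: addr_ge0]|].
- exact (@weighted_ge0 _ _ _ leb2 O mO _ N ms sN _ s0 fx).
- exact (@weighted_ge0 _ _ _ leb2 O mO _ N ms sN _ s0 fy).
- apply: (@Rintegral_ge0 _ _ _ arclength GR) => x _.
  by rewrite -mulrA mulr_ge0 ?(ltW (adm_a hp))// -expr2 sqr_ge0.
Qed.

Lemma ip_projP phi psi : HH p phi -> HH p psi ->
  ip p (projP phi) psi = cform phi.1 psi.1.
Proof.
move=> h k; rewrite ipE//; last exact: HH_projP.
have -> : sform (projP phi).2 psi.2 = 0.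
  rewrite /sform !(@Rintegral_eq0 _ _ _ leb2 O) ?addr0// => x _;
    by rewrite mulr0 mul0r.
have -> : rform (projP phi).2 psi.2 = 0.
  by apply: (@Rintegral_eq0 _ _ _ arclength GR) => x _; rewrite mulr0 mul0r.
by rewrite !addr0.
Qed.

Lemma ip_projS phi psi : HH p phi -> HH p psi ->
  ip p (0, phi.2) psi = sform phi.2 psi.2 + rform phi.2 psi.2.
Proof.
move=> h k; rewrite ipE//; last exact: HH_projS.
have -> : cform 0 psi.1 = 0; last by rewrite add0r.
by apply: (@Rintegral_eq0 _ _ _ leb2 O) => x _; rewrite mulr0 mul0r.
Qed.

Lemma hform_bound : exists2 k : R, 0 < k &
  forall f, sqint leb2 O f -> `|hform f f| <= k * cform f f.
Proof.
have [_ [N hN]] := adm_h hp; have [_ [m [M [m0 cM]]]] := adm_c hp.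
have k0 : 0 < (`|N| + 1) / m by rewrite divr_gt0// ltr_wpDl.
exists ((`|N| + 1) / m) => // f sf; have [M' cM'] := bnd (adm_c hp).
refine (@weighted_norm_le _ _ _ leb2 O mO _ N mh hN _ M' _ f mc cM' _ sf).
refine (ae_imp2 hN cM _) => x h h' Ox.
apply: le_trans (h Ox) _; have /andP[mcx _] := h' Ox.
rewrite -mulrA (le_trans (ler_norm N))//.
apply: (@le_trans _ _ ((`|N| + 1) * 1)); first by rewrite mulr1 lerDl.
by rewrite ler_wpM2l ?addr_ge0// ler_pdivlMl// mulr1.
Qed.

Lemma ip_lin_r phi phi' psi (a : R) : HH p phi -> HH p phi' -> HH p psi ->
  ip p psi (a *: phi + phi') = a * ip p psi phi + ip p psi phi'.
Proof. by move=> h h' k; rewrite ip_sym ip_lin// !(ip_sym _ psi). Qed.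

Lemma ip_cauchy_schwarz phi psi : HH p phi -> HH p psi ->
  ip p phi psi ^+ 2 <= ip p phi phi * ip p psi psi.
Proof.
move=> h k; apply: quadratic_ge0 => [|t]; first exact: ip_ge0.
have hk := HH_lin t h k; have := ip_ge0 hk.
rewrite ip_lin// !ip_lin_r// (ip_sym psi phi); congr (_ <= _); ring.
Qed.

Lemma ip_null phi psi : HH p phi -> HH p psi -> ip p psi psi = 0 ->
  ip p phi psi = 0.
Proof.
move=> h k k0; have := ip_cauchy_schwarz h k; rewrite k0 mulr0 => h0.
by apply/eqP; rewrite -sqrf_eq0 eq_le h0 sqr_ge0.
Qed.

Lemma eqHH_ip_null phi psi : hilbert_space p -> HH p phi -> HH p psi ->
  eqHH p phi psi -> ip p (phi - psi) (phi - psi) = 0.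
Proof.
move=> [def _] h k [e1 [r r0 e2]]; apply/(def _ (HHB h k)); split.
  refine (ae_imp e1 _) => x e Ox.
  change (phi.1 x - psi.1 x = 0); by rewrite e// subrr.
exists r => //; refine (ae_imp e2 _) => x e Ox.
by rewrite -e//; change (phi.2.1.1 x - psi.2.1.1 x - 0 = phi.2.1.1 x - psi.2.1.1 x); rewrite subr0.
Qed.

Lemma ip_null_eqHH phi psi : hilbert_space p -> HH p phi -> HH p psi ->
  ip p (phi - psi) (phi - psi) = 0 -> eqHH p phi psi.
Proof.
move=> [def _] h k /(def _ (HHB h k))[e1 [r r0 e2]]; split.
  refine (ae_imp e1 _) => x e Ox; apply/eqP; rewrite -subr_eq0; apply/eqP.
  exact: e.
exists r => //; refine (ae_imp e2 _) => x e Ox.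
rewrite -e//; change (phi.2.1.1 x - psi.2.1.1 x = phi.2.1.1 x - psi.2.1.1 x - 0); by rewrite subr0.
Qed.

(* The flux conditions tested with the second component [v] of the image of
   [psi], which represents both [psi.1] and [l' *: psi.2]. *)
Lemma eigen_projP (l l' : R) phi psi : hilbert_space p ->
  opA p phi (l *: phi) -> opA p psi (l' *: psi) ->
  (l + l') * ip p (projP phi) psi = l' * ip p phi psi + hform phi.1 psi.1.
Proof.
move=> hs [h _ [v0 [d [_ d2 _ flux [deq _]]]]] [k lk [v [d' [[Vv veq] _ _ _ [_ veq']]]]].
have [f2 _] := h; have [g2 _] := k; have [[hv2 hvx hvy _] _ _] := Vv.
have Hv : HH p (0, v) by split; [exact: (HH0 h).1|].
have HS := HH_projS k.
have HlS := HHZ l' HS.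
have eqv : eqHH p (l' *: (0, psi.2)) (0, v).
  split; last exact (veq' : eqH p (l' *: psi.2) v).
  by apply: aeW => x _; change (l' * 0 = 0 :> R); rewrite mulr0.
have null := ip_null h (HHB HlS Hv) (eqHH_ip_null hs HlS Hv eqv).
have E1 : ip p phi (0, v) = l' * ip p phi (0, psi.2).
  have := ip_lin_r (-1) Hv HlS h; rewrite scaleN1r addrC null mulN1r.
  have := ip_lin_r l' HS (HH0 h) h; rewrite addr0 => ->.
  have -> : ip p phi 0 = 0 by have := ip_lin_r (-1) h h h; rewrite scaleN1r addNr mulN1r addNr.
  by move=> e; apply/eqP; rewrite -subr_eq0 -oppr_eq0; apply/eqP; move: e; lra.
have E2 : ip p phi (0, psi.2) = ip p phi psi - ip p (projP phi) psi.
  rewrite ip_sym ip_projS// [ip p phi psi]ip_sym ipE// ip_projP// cformC; ring.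
have [M cM] := bnd (adm_c hp); have [N sN] := bnd (adm_sigma hp).
have [_ [L hL]] := adm_h hp.
have [[_ fx fy _] _ _] := h.2.
have E3 : ip p phi (0, v) = l * cform phi.1 psi.1 - hform phi.1 psi.1.
  rewrite ipE//.
  have -> : cform phi.1 (0, v).1 = 0.
    by apply: (@Rintegral_eq0 _ _ _ leb2 O) => x _; rewrite mulr0.
  have dvE : \int[leb2]_(x in O) (d x * Defs.sfun v x) =
      - l * cform phi.1 psi.1 + hform phi.1 psi.1.
    apply: etrans (@Rintegral_lin _ _ _ leb2 O mO _ _ (- l)
      (@sqint_bounded_mul _ _ _ leb2 O mO _ M _ _ mc cM f2 g2)
      (@sqint_bounded_mul _ _ _ leb2 O mO _ L _ _ mh hL f2 g2)).
    refine (@ae_eq_Rintegral _ _ _ leb2 O mO _ _ _ _ _).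
    - exact (measurable_funM d2.1 hv2.1).
    - exact (measurable_funD
        (measurable_funM (measurable_cst (- l))
          (measurable_funM (measurable_funM mc f2.1) g2.1))
        (measurable_funM (measurable_funM mh f2.1) g2.1)).
    - have [_ [m [M' [m0 mM]]]] := adm_c hp.
      refine (ae_imp2 (ae_imp2 veq deq (fun x a b => conj a b)) mM _).
      move=> x [vx dx] cx Ox; rewrite (vx Ox).
      have /andP[mcx _] := cx Ox; have c0 : cc p x != 0 by rewrite gt_eqF// (lt_le_trans m0).
      have dx' : l * phi.1 x = (cc p x)^-1 * hh p x * phi.1 x - (cc p x)^-1 * d x := dx Ox.
      have -> : d x = hh p x * phi.1 x - cc p x * (l * phi.1 x).
        by rewrite dx'; field.
      ring.
  have := flux v Vv.
  have -> : normal_flux p phi.2 d v =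
      sform phi.2 v + \int[leb2]_(x in O) (d x * Defs.sfun v x).
    apply: etrans (@RintegralD _ _ _ leb2 O _ _ mO
      (@weighted_grad_integrable _ _ _ leb2 O mO (sg p) N ms sN _ _ _ _ fx hvx fy hvy)
      (@sqint_mul _ _ _ leb2 O mO _ _ d2 hv2)) _.
    congr (_ + _).
    exact (@weighted_gradE _ _ _ leb2 O mO (sg p) N ms sN _ _ _ _ fx hvx fy hvy).
  by rewrite dvE -/(rform _ _); lra.
have := E3; rewrite E1 E2 -(ip_projP h k); lra.
Qed.

Lemma hform_lin f g k (a : R) : sqint leb2 O f -> sqint leb2 O g ->
  sqint leb2 O k -> hform (a *: f + g) k = a * hform f k + hform g k.
Proof.
have [_ [L hL]] := adm_h hp => sf sg sk.
exact (@weighted_lin _ _ _ leb2 O mO _ L mh hL _ _ _ a sf sg sk).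
Qed.

Lemma hformC f g : hform f g = hform g f.
Proof. by refine (@eq_Rintegral _ _ _ leb2 O _ _ _) => x _; ring. Qed.

Lemma projP_lin phi psi (a : R) :
  projP (a *: phi + psi) = a *: projP phi + projP psi.
Proof. by rewrite /projP; congr pair; rewrite /= scaler0 addr0. Qed.

Lemma ip_projP_sym phi psi : HH p phi -> HH p psi ->
  ip p (projP phi) psi = ip p phi (projP psi).
Proof. by move=> h k; rewrite ip_projP// cformC -ip_projP// ip_sym. Qed.

Lemma ip_projPP phi : HH p phi ->
  ip p (projP phi) (projP phi) = ip p (projP phi) phi.
Proof. by move=> h; rewrite !ip_projP//; exact: HH_projP. Qed.

Lemma ip_projP_le phi : HH p phi -> ip p (projP phi) phi <= ip p phi phi.
Proof.
move=> h; have hP := HH_projP h; have := ip_ge0 (HHB h hP).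
have E : phi - projP phi = -1 *: projP phi + phi by rewrite scaleN1r addrC.
rewrite E ip_lin ?ip_lin_r//; last by rewrite -E; exact: HHB.
by rewrite ip_projPP// [ip p phi (projP _)]ip_sym; lra.
Qed.

Lemma hnorm_sq phi : HH p phi -> hnorm p phi ^+ 2 = ip p phi phi.
Proof. by move=> h; rewrite sqr_sqrtr// ip_ge0. Qed.

Lemma hnorm_ge0 phi : 0 <= hnorm p phi.
Proof. exact: sqrtr_ge0. Qed.

Lemma ip_le_hnorm phi psi : HH p phi -> HH p psi ->
  `|ip p phi psi| <= hnorm p phi * hnorm p psi.
Proof.
move=> h k; rewrite -ler_sqr ?nnegrE ?mulr_ge0 ?hnorm_ge0//.
by rewrite real_normK ?num_real// exprMn !hnorm_sq// ip_cauchy_schwarz.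
Qed.

Lemma hnorm_le phi psi : HH p phi -> HH p psi ->
  ip p phi phi <= ip p psi psi -> hnorm p phi <= hnorm p psi.
Proof. by move=> h k le; rewrite ler_wsqrtr. Qed.

Lemma hnormD phi psi : HH p phi -> HH p psi ->
  hnorm p (phi + psi) <= hnorm p phi + hnorm p psi.
Proof.
move=> h k; have hk := HHD h k.
rewrite -ler_sqr ?nnegrE ?addr_ge0 ?hnorm_ge0// hnorm_sq//.
have E : phi + psi = 1 *: phi + psi by rewrite scale1r.
have -> : ip p (phi + psi) (phi + psi) =
    ip p phi phi + 2 * ip p phi psi + ip p psi psi.
  rewrite {1}E ip_lin// {1}E ip_lin_r// {1}E ip_lin_r// [ip p psi phi]ip_sym; ring.
have := le_trans (ler_norm _) (ip_le_hnorm h k).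
by rewrite -!hnorm_sq//; lra.
Qed.

Lemma ip_subl phi phi' psi : HH p phi -> HH p phi' -> HH p psi ->
  ip p (phi - phi') psi = ip p phi psi - ip p phi' psi.
Proof.
by move=> h h' k; rewrite addrC -scaleN1r ip_lin// mulN1r addrC.
Qed.

Lemma ip_addl phi phi' psi : HH p phi -> HH p phi' -> HH p psi ->
  ip p (phi + phi') psi = ip p phi psi + ip p phi' psi.
Proof. by move=> h h' k; rewrite -[phi]scale1r ip_lin// scale1r mul1r. Qed.

Lemma ip_opp phi : ip p (- phi) (- phi) = ip p phi phi.
Proof.
congr (_ + _).
  refine (@eq_Rintegral _ _ _ leb2 O _ _ _) => x _.
  change (cc p x * (- phi.1 x) * (- phi.1 x) + sg p x *
    ((- sdx phi.2 x) * (- sdx phi.2 x) + (- sdy phi.2 x) * (- sdy phi.2 x)) =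
    cc p x * phi.1 x * phi.1 x + sg p x *
    (sdx phi.2 x * sdx phi.2 x + sdy phi.2 x * sdy phi.2 x)).
  ring.
refine (@eq_Rintegral _ _ _ arclength GR _ _ _) => x _.
change (aa p * (- str phi.2 x) * (- str phi.2 x) = aa p * str phi.2 x * str phi.2 x).
ring.
Qed.

Lemma hnormN phi : hnorm p (- phi) = hnorm p phi.
Proof. by rewrite /hnorm ip_opp. Qed.

Lemma hnorm_projP phi : HH p phi -> hnorm p (projP phi) <= hnorm p phi.
Proof.
move=> h; apply: hnorm_le => //; first exact: HH_projP.
by rewrite ip_projPP// ip_projP_le.
Qed.

End EnergyForm.

(** * Closed subspaces of a Hilbert space *)

Section ClosedSubspace.
Context {R : realType} (V : lmodType R) (E F : set V) (ip : V -> V -> R).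
Let nrm x : R := Num.sqrt (ip x x).
Hypotheses (E_lin : forall a x y, E x -> E y -> E (a *: x + y))
  (ipC : forall x y, ip x y = ip y x)
  (ip_lin : forall a x y z, E x -> E y -> E z ->
    ip (a *: x + y) z = a * ip x z + ip y z)
  (ip_ge0 : forall x, E x -> 0 <= ip x x)
  (cauchy_schwarz : forall x y, E x -> E y -> `|ip x y| <= nrm x * nrm y)
  (nrmD : forall x y, E x -> E y -> nrm (x + y) <= nrm x + nrm y)
  (complete : forall u : V^nat, (forall n, E (u n)) ->
    (forall e, 0 < e -> exists N, forall m n, (N <= m)%N -> (N <= n)%N ->
      nrm (u m - u n) < e) ->
    exists2 l, E l & (fun n => nrm (u n - l)) @ \oo --> 0).
Hypotheses (F_sub : F `<=` E) (F0 : F 0)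
  (F_lin : forall a x y, F x -> F y -> F (a *: x + y))
  (F_closed : forall x, E x ->
    (forall e, 0 < e -> exists2 y, F y & nrm (x - y) < e) -> F x).

Let nrm_ge0 x : 0 <= nrm x. Proof. exact: sqrtr_ge0. Qed.

Let nrm_sq x : E x -> nrm x ^+ 2 = ip x x.
Proof. by move=> hx; rewrite sqr_sqrtr// ip_ge0. Qed.

Let E0 : E 0. Proof. exact: F_sub. Qed.

Let ED x y : E x -> E y -> E (x + y).
Proof. by move=> hx hy; rewrite -[x]scale1r; exact: E_lin. Qed.

Let EZ a x : E x -> E (a *: x).
Proof. by move=> hx; rewrite -[a *: x]addr0; exact: E_lin. Qed.

Let EB x y : E x -> E y -> E (x - y).
Proof. by move=> hx hy; rewrite addrC -scaleN1r; exact: E_lin. Qed.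

Let FD x y : F x -> F y -> F (x + y).
Proof. by move=> hx hy; rewrite -[x]scale1r; exact: F_lin. Qed.

Let FZ a x : F x -> F (a *: x).
Proof. by move=> hx; rewrite -[a *: x]addr0; exact: F_lin. Qed.

Let FB x y : F x -> F y -> F (x - y).
Proof. by move=> hx hy; rewrite addrC -scaleN1r; exact: F_lin. Qed.

Let ipD x y z : E x -> E y -> E z -> ip (x + y) z = ip x z + ip y z.
Proof. by move=> hx hy hz; rewrite -[x]scale1r ip_lin// scale1r mul1r. Qed.

Let ipB x y z : E x -> E y -> E z -> ip (x - y) z = ip x z - ip y z.
Proof. by move=> hx hy hz; rewrite addrC -scaleN1r ip_lin// mulN1r addrC. Qed.

Let ip0 z : E z -> ip 0 z = 0.
Proof. by move=> hz; have := ipB hz hz hz; rewrite !subrr. Qed.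

Let ipZ a x z : E x -> E z -> ip (a *: x) z = a * ip x z.
Proof. by move=> hx hz; rewrite -[a *: x]addr0 ip_lin// ip0// addr0. Qed.

Let sqB x y : E x -> E y -> ip (x - y) (x - y) = ip x x - 2 * ip x y + ip y y.
Proof.
move=> hx hy; rewrite (ipB hx hy (EB hx hy)) (ipC x (x - y)) (ipC y (x - y)).
by rewrite (ipB hx hy hx) (ipB hx hy hy) (ipC y x); ring.
Qed.

Let sqD x y : E x -> E y -> ip (x + y) (x + y) = ip x x + 2 * ip x y + ip y y.
Proof.
move=> hx hy; rewrite (ipD hx hy (ED hx hy)) (ipC x (x + y)) (ipC y (x + y)).
by rewrite (ipD hx hy hx) (ipD hx hy hy) (ipC y x); ring.
Qed.

Let nrmC x y : E x -> E y -> nrm (x - y) = nrm (y - x).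
Proof.
move=> hx hy; rewrite /nrm !sqB// [ip x y]ipC; congr Num.sqrt; ring.
Qed.

Let nrm_lt x e : 0 < e -> E x -> ip x x < e ^+ 2 -> nrm x < e.
Proof.
by move=> e0 hx h; rewrite -ltr_sqr ?nnegrE ?nrm_ge0 ?ltW// nrm_sq.
Qed.

Lemma projection_exists x : E x ->
  exists2 y, F y & forall z, F z -> ip (x - y) z = 0.
Proof.
move=> hx; pose S := [set ip (x - y) (x - y) | y in F].
have hS : has_inf S.
  split; first by exists (ip (x - 0) (x - 0)), 0.
  by exists 0 => _ [y /F_sub hy <-]; exact/ip_ge0/EB.
pose d := inf S.
have dS y : F y -> d <= ip (x - y) (x - y).
  by move=> hy; apply: ge_inf; [exact: hS.2|exists y].
have near n : exists y, F y /\ ip (x - y) (x - y) < d + n.+1%:R^-1.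
  have n0 : 0 < n.+1%:R^-1 :> R by rewrite invr_gt0.
  by have [_ [y hy <-] yd] := inf_adherent n0 hS; exists y.
have [u uP] := choice near.
have uE n : E (u n) by apply: F_sub; exact: (uP n).1.
have par m n : ip (u m - u n) (u m - u n) <= 2 * m.+1%:R^-1 + 2 * n.+1%:R^-1.
  have h := dS _ (FZ 2^-1 (FD (uP m).1 (uP n).1)).
  have hm := uE m; have hn := uE n; have hm' := (uP m).2; have hn' := (uP n).2.
  have xm := EB hx hm; have xn := EB hx hn.
  have E1 : x - 2^-1 *: (u m + u n) = 2^-1 *: ((x - u m) + (x - u n)).
    rewrite addrACA -opprD scalerBr; congr (_ - _).
    have h2 : 2^-1 + 2^-1 = 1 :> R by field.
    by rewrite scalerDr -scalerDl h2 scale1r.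
  have E2 : u m - u n = (x - u n) - (x - u m).
    by rewrite opprB [RHS]addrC addrA subrK.
  rewrite E1 (ipZ _ (ED xm xn) (EZ _ (ED xm xn))) ipC (ipZ _ (ED xm xn) (ED xm xn)) in h.
  have -> : ip (u m - u n) (u m - u n) = 2 * ip (x - u m) (x - u m) +
      2 * ip (x - u n) (x - u n) - ip (x - u m + (x - u n)) (x - u m + (x - u n)).
    by rewrite E2 (sqB xn xm) (sqD xm xn) (ipC (x - u n) (x - u m)); ring.
  move: h hm' hn'; move: (ip _ _) (ip (x - u m) _) (ip (x - u n) _).
  move: m.+1%:R^-1 n.+1%:R^-1 => a b ? ? ?; lra.
have [|l hl ul] := complete uE.
  move=> e e0; have e20 : 0 < e ^+ 2 / 4 by rewrite divr_gt0// exprn_gt0.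
  have [N _ hN] := near_infty_natSinv_lt (PosNum e20).
  exists N => m n Nm Nn; apply: nrm_lt => //; first exact: EB.
  apply: le_lt_trans (par m n) _.
  have := hN m Nm; have := hN n Nn; rewrite /=.
  by move: m.+1%:R^-1 n.+1%:R^-1 => a b; lra.
have near_l e : 0 < e -> exists2 y, F y & nrm (l - y) < e /\ ip (x - y) (x - y) < d + e.
  move=> e0; have [N _ hN] := near_infty_natSinv_lt (PosNum e0).
  have /cvgrPdist_lt/(_ e e0)[M _ hM] := ul.
  pose k := maxn N M; exists (u k); first exact: (uP k).1.
  split; last first.
    by apply: lt_trans (uP k).2 _; rewrite ltrD2l; apply: hN; exact: leq_maxl.
  rewrite nrmC//; have := hM k (leq_maxr _ _).
  by rewrite /= sub0r normrN ger0_norm.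
have Fl : F l.
  by apply: F_closed => // e /near_l[y Fy [ly _]]; exists y.
exists l => // z Fz; have Ez := F_sub Fz; have xl := EB hx hl.
have dl : ip (x - l) (x - l) <= d.
  apply/ler_addgt0Pr => e e0; pose D := nrm (x - l).
  have D0 : 0 <= D by exact: nrm_ge0.
  have c0 : 0 < 4 + 2 * D by rewrite ltr_pwDl// mulr_ge0.
  have r0 : 0 < Num.min 1 (e / (4 + 2 * D)) by rewrite lt_min ltr01 divr_gt0.
  have [y /F_sub hy [ly xy]] := near_l _ r0; move: r0 ly xy.
  have : Num.min 1 (e / (4 + 2 * D)) <= 1 by rewrite ge_min lexx.
  have : Num.min 1 (e / (4 + 2 * D)) * (4 + 2 * D) <= e.
    by rewrite -ler_pdivlMr// ge_min lexx orbT.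
  move: (Num.min _ _) => r re r1 r0 ly xy.
  have E1 : x - l = (x - y) - (l - y) by rewrite opprB addrA subrK.
  have E2 : x - y = (x - l) + (l - y) by rewrite addrA subrK.
  have xy' := EB hx hy; have ly' := EB hl hy.
  rewrite E1 sqB//.
  have n1 : nrm (x - y) <= D + r.
    by rewrite E2 (le_trans (nrmD xl ly'))// lerD2l ltW.
  have : `|ip (x - y) (l - y)| <= (D + r) * r.
    by apply: le_trans (cauchy_schwarz xy' ly') _; rewrite ler_pM// ltW.
  have : ip (l - y) (l - y) <= r * 1.
    rewrite -nrm_sq// expr2; apply: ler_pM => //; [exact: ltW|exact: le_trans (ltW ly) r1].
  have := ler_norm (- ip (x - y) (l - y)); rewrite normrN.
  have : (D + r) * r <= (D + 1) * r by rewrite ler_wpM2r ?lerD2l// ltW.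
  by move: xy re; set a := ip (x - y) (x - y); set b := ip (x - y) (l - y);
    set c := ip (l - y) (l - y); lra.
have h : (- ip (x - l) z) ^+ 2 <= ip z z * 0.
  apply: quadratic_ge0 => [|t]; first exact: ip_ge0.
  have := dS _ (FD Fl (FZ t Fz)).
  have -> : x - (l + t *: z) = (x - l) - t *: z by rewrite opprD addrA.
  have tz := EZ t Ez.
  rewrite (sqB xl tz) (ipC (x - l)) (ipZ t Ez xl) (ipZ t Ez tz) (ipC z (t *: z)).
  rewrite (ipZ t Ez Ez) (ipC z (x - l)).
  by move=> dt; have := le_trans dl dt; rewrite expr2; lra.
by apply/eqP; rewrite -sqrf_eq0 -sqrrN eq_le sqr_ge0 andbT (le_trans h)// mulr0.
Qed.

Variable P : V -> V.
Hypotheses (P_E : forall x, E x -> E (P x))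
  (P_lin : forall a x y, P (a *: x + y) = a *: P x + P y)
  (P_sq : forall x, E x -> ip (P x) (P x) = ip (P x) x)
  (P_le : forall x, E x -> ip (P x) x <= ip x x).

Definition represents g x := forall z, F z -> ip (P x) z = ip g z.

Lemma represented x : F x -> exists2 g, F g & represents g x.
Proof.
move=> /F_sub/P_E hx; have [g Fg xg] := projection_exists hx.
exists g => // z Fz; apply/eqP; rewrite -subr_eq0 -ipB ?xg//; exact: F_sub.
Qed.

Lemma represents_lin a g h x y : F g -> F h -> F x -> F y ->
  represents g x -> represents h y -> represents (a *: g + h) (a *: x + y).
Proof.
move=> /F_sub Eg /F_sub Eh /F_sub Ex /F_sub Ey gx hy z Fz; have Ez := F_sub Fz.
by rewrite P_lin ip_lin ?(ip_lin a Eg)// ?gx ?hy//; exact: P_E.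
Qed.

Lemma represents_le g x : F g -> F x -> represents g x -> ip g g <= ip (P x) x.
Proof.
move=> Fg Fx gx; have Eg := F_sub Fg; have Ex := F_sub Fx; have EP := P_E Ex.
have := ip_ge0 (EB EP Eg); rewrite sqB// P_sq// (gx g Fg); lra.
Qed.

Variable C : R.
Hypotheses (C1 : 1 <= C)
  (lower : forall g x, F g -> F x -> represents g x -> nrm x <= C * nrm g).

(* Richardson iteration: [r] is the residual of the approximate solution [x]. *)
Lemma residual n y : F y -> exists x r, [/\ F x, F r, represents (y - r) x &
  ip r r <= (1 - C^-2) ^+ n * ip y y].
Proof.
have C0 : 0 < C by exact: lt_le_trans C1.
have q0 : 0 <= 1 - C^-2.
  by rewrite subr_ge0 invf_le1 ?exprn_gt0// exprn_ege1.
move=> Fy; elim: n => [|n [x [r [Fx Fr xr rn]]]].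
  exists 0, y; split => //; last by rewrite expr0 mul1r.
  move=> z Fz; rewrite subrr; have /(congr1 (fun v => ip v z)) := P_lin (-1) 0 0.
  rewrite !scaleN1r !addNr; by [].
have [g Fg rg] := represented Fr; have Er := F_sub Fr; have Eg := F_sub Fg.
exists (x + r), (r - g); split; [exact: FD|exact: FB| |].
  have := represents_lin 1 (FB Fy Fr) Fg Fx Fr xr rg.
  by rewrite !scale1r opprB addrA addrAC.
have le1 := represents_le Fg Fr rg.
have lo : ip r r <= C ^+ 2 * ip g g.
  rewrite -!nrm_sq// -exprMn ler_sqr ?nnegrE ?mulr_ge0 ?nrm_ge0 ?(ltW C0)//.
  exact: lower.
have lo' : C^-2 * ip r r <= ip g g by rewrite ler_pdivrMl ?exprn_gt0.
have rgE : ip r g = ip (P r) r by rewrite ipC -(rg r Fr).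
rewrite sqB// rgE exprSr.
have := ler_wpM2r q0 rn; rewrite mulrAC mulrBr mulr1 [ip r r * _]mulrC.
by move: lo' le1; set a := ip r r; set b := ip g g; set c := ip (P r) r; lra.
Qed.

Lemma weak_solution y : F y -> exists2 x, F x & represents y x.
Proof.
move=> Fy; have Ey := F_sub Fy; have C0 : 0 < C by exact: lt_le_trans C1.
have /choice[u uP] : forall n, exists xr : V * V, [/\ F xr.1, F xr.2,
    represents (y - xr.2) xr.1 & ip xr.2 xr.2 <= (1 - C^-2) ^+ n * ip y y].
  by move=> n; have [x [r h]] := residual n Fy; exists (x, r).
pose x n := (u n).1; pose r n := (u n).2.
have Fx n : F (x n) by have [] := uP n.
have Fr n : F (r n) by have [] := uP n.
have Ex n := F_sub (Fx n); have Er n := F_sub (Fr n).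
have xr n : represents (y - r n) (x n) by have [] := uP n.
have r_small e : 0 < e -> exists N, forall n, (N <= n)%N -> nrm (r n) < e.
  move=> e0; have q1 : `|1 - C^-2| < 1.
    rewrite ger0_norm; first by rewrite ltrBlDr ltrDl invr_gt0 exprn_gt0.
    by rewrite subr_ge0 invf_le1 ?exprn_gt0// exprn_ege1.
  have t0 : 0 < e ^+ 2 / (ip y y + 1) by rewrite divr_gt0 ?exprn_gt0// ltr_wpDl ?ip_ge0.
  have /cvgrPdist_lt/(_ _ t0)[N _ hN] := cvg_expr q1.
  exists N => n Nn; apply: nrm_lt => //; have [_ _ _ rn] := uP n.
  apply: le_lt_trans rn _; have := hN n Nn; rewrite /= sub0r normrN => /(le_lt_trans (ler_norm _)).
  rewrite ltr_pdivlMr ?ltr_wpDl ?ip_ge0// => h.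
  apply: le_lt_trans h; rewrite mulrDr mulr1 lerDl exprn_ge0//.
  by rewrite subr_ge0 invf_le1 ?exprn_gt0// exprn_ege1.
have [|l El xl] := complete Ex.
  move=> e e0; have [N hN] := r_small (e / (2 * C)) ltac:(by rewrite divr_gt0 ?mulr_gt0).
  exists N => m n /hN rm /hN rn.
  have W : represents (r n - r m) (x m - x n).
    have := represents_lin (-1) (FB Fy (Fr n)) (FB Fy (Fr m)) (Fx n) (Fx m) (xr n) (xr m).
    by rewrite !scaleN1r opprB addrA subrK [- x n + _]addrC.
  apply: le_lt_trans (lower (FB (Fr n) (Fr m)) (FB (Fx m) (Fx n)) W) _.
  have : nrm (r n - r m) <= nrm (r n) + nrm (r m).
    apply: le_trans (nrmD (Er n) _) _; first by rewrite -scaleN1r; exact: EZ.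
    by rewrite lerD2l -[- r m]sub0r nrmC// subr0.
  move=> le2; rewrite -ltr_pdivlMl// mulrC.
  apply: le_lt_trans le2 _; have : e / (2 * C) + e / (2 * C) = e / C by field; rewrite gt_eqF.
  by move: rm rn; move: (nrm _) (nrm (r n)) => a b; lra.
exists l.
  apply: F_closed => // e e0; have /cvgrPdist_lt/(_ e e0)[N _ hN] := xl.
  exists (x N) => //; have := hN N (leqnn N).
  by rewrite /= sub0r normrN ger0_norm// nrmC.
move=> z Fz; have Ez := F_sub Fz; apply/eqP; rewrite -subr_eq0 -normr_le0.
apply/ler_addgt0Pr => e e0; rewrite add0r.
have t0 : 0 < e / (2 * (nrm z + 1)) by rewrite divr_gt0// mulr_gt0// ltr_wpDl.
have [N hN] := r_small _ t0; have /cvgrPdist_lt/(_ _ t0)[M _ hM] := xl.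
pose k := maxn N M; have rk := hN k (leq_maxl _ _).
have lk : nrm (l - x k) < e / (2 * (nrm z + 1)).
  by have := hM k (leq_maxr _ _); rewrite /= sub0r normrN ger0_norm// nrmC.
have -> : ip (P l) z - ip y z = ip (P (l - x k)) z - ip (r k) z.
  have -> : P (l - x k) = P l - P (x k).
    by rewrite [l - x k]addrC -scaleN1r P_lin scaleN1r addrC.
  rewrite (ipB (P_E El) (P_E (Ex k)) Ez) (xr k z Fz) (ipB Ey (Er k) Ez).
  ring.
apply: le_trans (ler_normB _ _) _.
have b1 : `|ip (P (l - x k)) z| <= nrm (l - x k) * nrm z.
  have Elk := EB El (Ex k).
  apply: le_trans (cauchy_schwarz (P_E Elk) Ez) _; apply: ler_wpM2r => //.
  by rewrite ler_wsqrtr// P_sq// P_le.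
have b2 := cauchy_schwarz (Er k) Ez.
have z0 := nrm_ge0 z.
have c1 := ler_wpM2r z0 (ltW lk); have c2 := ler_wpM2r z0 (ltW rk).
have : e / (2 * (nrm z + 1)) * nrm z <= e / 2.
  have -> : e / (2 * (nrm z + 1)) * nrm z = e / 2 * (nrm z / (nrm z + 1)).
    by field; rewrite gt_eqF// ltr_wpDl.
  have z1 : nrm z / (nrm z + 1) <= 1 by rewrite ler_pdivrMr ?ltr_wpDl// mul1r lerDl.
  have e2 : 0 <= e / 2 by rewrite divr_ge0// ltW.
  by have := ler_wpM2l e2 z1; rewrite mulr1.
move: (e / _ * _) c1 c2 => w c1 c2 we; have := le_trans b1 c1; have := le_trans b2 c2; lra.
Qed.

End ClosedSubspace.

(** * The spectral subspaces *)

Section SpectralSubspace.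
Context {R : realType} (p : problem R) (hp : admissible p) (hs : hilbert_space p).
Variables (phi : int -> preHH R) (I : set int).
Hypotheses (I0 : I !=set0) (phiHH : forall i, I i -> HH p (phi i))
  (phi_gt0 : forall i, I i -> 0 < ip p (phi i) (phi i))
  (phi_orth : forall i j, I i -> I j -> i != j -> ip p (phi i) (phi j) = 0).
Implicit Types (x y z : preHH R) (s : seq int) (b : int -> R).

Local Notation F := (closed_span p I phi).
Local Notation nsq := (fun i => ip p (phi i) (phi i)).

Definition coef x (i : int) : R := ip p x (phi i) / ip p (phi i) (phi i).

Definition fourier s x : preHH R := lincomb phi s (coef x).

Let HH00 : HH p 0. Proof. by have [i Ii] := I0; exact: HH0 (phiHH Ii). Qed.

Lemma closed_span_HH x : F x -> HH p x. Proof. by case. Qed.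

Lemma ip0l x : HH p x -> ip p 0 x = 0.
Proof. by move=> h; have := ip_subl hp h h h; rewrite !subrr. Qed.

Lemma lincomb_HH s b : {in s, forall i, I i} -> HH p (lincomb phi s b).
Proof.
rewrite /lincomb; elim: s => [|i s IH] sI; first by rewrite big_nil.
rewrite big_cons; apply: HH_lin => //; first by apply/phiHH/sI/mem_head.
by apply: IH => j sj; apply: sI; rewrite inE sj orbT.
Qed.

Lemma lincomb_bilinear (Q : preHH R -> preHH R -> R) s b x :
  (forall a u v w, HH p u -> HH p v -> HH p w ->
    Q (a *: u + v) w = a * Q u w + Q v w) ->
  {in s, forall i, I i} -> HH p x ->
  Q (lincomb phi s b) x = \sum_(i <- s) b i * Q (phi i) x.
Proof.
move=> Ql + hx; rewrite /lincomb; elim: s => [|i s IH] sI.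
  rewrite !big_nil; have := Ql (-1) _ _ _ hx hx hx.
  by rewrite scaleN1r addNr mulN1r addNr.
have sI' : {in s, forall i, I i} by move=> j sj; apply: sI; rewrite inE sj orbT.
rewrite !big_cons Ql ?IH//; first by apply/phiHH/sI/mem_head.
exact: lincomb_HH.
Qed.

Lemma ip_lincombl s b x : {in s, forall i, I i} -> HH p x ->
  ip p (lincomb phi s b) x = \sum_(i <- s) b i * ip p (phi i) x.
Proof.
move=> sI hx; apply: lincomb_bilinear => // a u v w hu hv hw.
exact: ip_lin.
Qed.

Lemma ip_lincomb_phi s b j : uniq s -> {in s, forall i, I i} -> j \in s ->
  ip p (lincomb phi s b) (phi j) = b j * ip p (phi j) (phi j).
Proof.
move=> us sI sj; rewrite ip_lincombl//; last exact/phiHH/sI.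
rewrite (bigD1_seq j)//= big1_seq ?addr0// => i /andP[ij si].
by rewrite phi_orth ?mulr0//; exact: sI.
Qed.

Lemma lincomb_norm s b : uniq s -> {in s, forall i, I i} ->
  ip p (lincomb phi s b) (lincomb phi s b) = wnorm s nsq b.
Proof.
move=> us sI; rewrite ip_lincombl//; last exact: lincomb_HH.
apply: eq_big_seq => i si; rewrite ip_sym ip_lincomb_phi//.
by rewrite mulrA -expr2 mulrC.
Qed.

Lemma fourier_HH s x : {in s, forall i, I i} -> HH p (fourier s x).
Proof. exact: lincomb_HH. Qed.

Lemma ip_fourier_phi s x j : uniq s -> {in s, forall i, I i} -> j \in s ->
  ip p (fourier s x) (phi j) = ip p x (phi j).
Proof.
move=> us sI sj; rewrite ip_lincomb_phi// divfK//.
by rewrite gt_eqF// phi_gt0//; exact: sI.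
Qed.

Lemma ip_fourier_lincomb s x b : uniq s -> {in s, forall i, I i} -> HH p x ->
  ip p (fourier s x) (lincomb phi s b) = ip p x (lincomb phi s b).
Proof.
move=> us sI hx; have hP := fourier_HH x sI.
rewrite [LHS]ip_sym [RHS]ip_sym (ip_lincombl b sI hP) (ip_lincombl b sI hx).
by apply: eq_big_seq => i si; rewrite ip_sym ip_fourier_phi// ip_sym.
Qed.

Lemma fourier_norm s x : uniq s -> {in s, forall i, I i} -> HH p x ->
  ip p (fourier s x) (fourier s x) = ip p x (fourier s x).
Proof. by move=> us sI hx; rewrite ip_fourier_lincomb. Qed.

Lemma fourier_normE s x : uniq s -> {in s, forall i, I i} ->
  ip p (fourier s x) (fourier s x) =
  \sum_(i <- s) ip p x (phi i) ^+ 2 / ip p (phi i) (phi i).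
Proof.
move=> us sI; rewrite lincomb_norm//; apply: eq_big_seq => i /sI/phi_gt0 i0.
by rewrite /coef; field; rewrite gt_eqF.
Qed.

Lemma pythagoras x y : HH p x -> HH p y -> ip p (x - y) y = 0 ->
  ip p x x = ip p (x - y) (x - y) + ip p y y.
Proof.
move=> hx hy xy; have hu := HHB hp hx hy.
have E w : HH p w -> ip p x w = ip p (x - y) w + ip p y w.
  by move=> hw; rewrite -(ip_addl hp hu hy hw) subrK.
rewrite (E _ hx) [ip p (x - y) x]ip_sym [ip p y x]ip_sym (E _ hu) (E _ hy).
by rewrite [ip p y (x - y)]ip_sym xy addr0 add0r.
Qed.

Lemma bessel s x : uniq s -> {in s, forall i, I i} -> HH p x ->
  ip p (fourier s x) (fourier s x) <= ip p x x.
Proof.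
move=> us sI hx; have hP := fourier_HH x sI.
rewrite (pythagoras hx hP); first by rewrite lerDr ip_ge0//; exact: HHB.
by rewrite (ip_subl hp)// fourier_norm// subrr.
Qed.

(* [s] may contain repetitions, as allowed by [closed_span]. *)
Lemma fourier_best s b x : {in s, forall i, I i} -> HH p x ->
  hnorm p (x - fourier (undup s) x) <= hnorm p (x - lincomb phi s b).
Proof.
move=> sI hx; have us := undup_uniq s.
have sI' : {in undup s, forall i, I i} by move=> i; rewrite mem_undup; exact: sI.
set P := fourier _ x; set L := lincomb _ _ _.
have hP : HH p P by exact: fourier_HH.
have hL : HH p L by exact: lincomb_HH.
have orth i : i \in s -> ip p (phi i) (x - P) = 0.
  move=> si; have hi := phiHH (sI _ si).
  by rewrite ip_sym (ip_subl hp)// ip_fourier_phi ?mem_undup// subrr.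
have oL : ip p (x - P) L = 0.
  rewrite ip_sym ip_lincombl//; last exact: HHB.
  by rewrite big1_seq// => i /andP[_ /orth->]; rewrite mulr0.
have oP : ip p (x - P) P = 0.
  rewrite ip_sym ip_lincombl//; last exact: HHB.
  rewrite big1_seq// => i /andP[_]; rewrite mem_undup => /orth->.
  by rewrite mulr0.
have hxP := HHB hp hx hP; have hPL := HHB hp hP hL; clearbody P L.
apply: (hnorm_le (HHB hp hx hP) (HHB hp hx hL)).
have -> : x - L = (x - P) + (P - L) by rewrite addrA subrK.
have E : (x - P) + (P - L) - (P - L) = x - P by rewrite addrK.
rewrite [leRHS](pythagoras (HHD hp hxP hPL) hPL) E ?lerDl ?ip_ge0//.
by rewrite ip_sym (ip_subl hp hP hL hxP) ip_sym oP ip_sym oL subrr.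
Qed.

Lemma closed_spanP x : F x <-> HH p x /\ forall e, 0 < e ->
  exists s, [/\ uniq s, {in s, forall i, I i} & hnorm p (x - fourier s x) < e].
Proof.
split=> [[hx Fx]|[hx Fx]]; split=> // e /Fx.
  move=> [s [b [sI sb]]]; exists (undup s); split; first exact: undup_uniq.
    by move=> i; rewrite mem_undup; exact: sI.
  exact: le_lt_trans (fourier_best b sI hx) sb.
by move=> [s [us sI se]]; exists s, (coef x).
Qed.

Lemma lincomb_span s b : {in s, forall i, I i} -> F (lincomb phi s b).
Proof.
move=> sI; split; first exact: lincomb_HH.
move=> e e0; exists s, b; split=> //; rewrite subrr.
by rewrite /hnorm ip0l// sqrtr0.
Qed.

Lemma fourier_span s x : {in s, forall i, I i} -> F (fourier s x).
Proof. exact: lincomb_span. Qed.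

Lemma phi_span i : I i -> F (phi i).
Proof.
move=> Ii; have -> : phi i = lincomb phi [:: i] (fun=> 1).
  by rewrite /lincomb big_seq1 scale1r.
by apply: lincomb_span => j; rewrite inE => /eqP->.
Qed.

Lemma closed_span_closed x : HH p x ->
  (forall e, 0 < e -> exists2 y, F y & hnorm p (x - y) < e) -> F x.
Proof.
move=> hx near; split=> // e e0; have [y [hy Fy] xy] := near (e / 2) (divr_gt0 e0 (ltr0Sn _ _)).
have [s [b [sI yb]]] := Fy (e / 2) (divr_gt0 e0 (ltr0Sn _ _)).
exists s, b; split=> //; have hl := lincomb_HH b sI.
have -> : x - lincomb phi s b = (x - y) + (y - lincomb phi s b) by rewrite addrA subrK.
apply: le_lt_trans (hnormD hp (HHB hp hx hy) (HHB hp hy hl)) _; lra.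
Qed.

Lemma closed_span_eqHH x y : F x -> HH p y -> eqHH p x y -> F y.
Proof.
move=> Fx hy xy; apply: closed_span_closed => // e e0; exists x => //.
have hx := closed_span_HH Fx; rewrite -opprB hnormN.
by rewrite /hnorm (eqHH_ip_null hp hs hx hy xy) sqrtr0.
Qed.

Lemma lincomb_extend s t b : uniq s -> uniq t -> {subset s <= t} ->
  lincomb phi s b = lincomb phi t (fun i => if i \in s then b i else 0).
Proof.
move=> us ut st; rewrite /lincomb.
rewrite [RHS](eq_bigr (fun i => if i \in s then b i *: phi i else 0)); last first.
  by move=> i _; case: ifP => // _; rewrite scale0r.
rewrite -big_mkcond -[RHS]big_filter; apply: perm_big.
apply: uniq_perm => //; first exact: filter_uniq.
by move=> i; rewrite mem_filter; case: (boolP (i \in s)) => // /st->.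
Qed.

Lemma fourier_mono s t x : uniq s -> uniq t -> {subset s <= t} ->
  {in t, forall i, I i} -> HH p x ->
  hnorm p (x - fourier t x) <= hnorm p (x - fourier s x).
Proof.
move=> us ut st tI hx; have := fourier_best (fun i => if i \in s then coef x i else 0) tI hx.
by rewrite (undup_id ut) -(lincomb_extend (coef x) us ut st).
Qed.

Lemma span_approx x s e : F x -> 0 < e -> uniq s -> {in s, forall i, I i} ->
  exists t, [/\ uniq t, {in t, forall i, I i}, {subset s <= t} &
    hnorm p (x - fourier t x) < e].
Proof.
move=> /closed_spanP[hx Fx] /Fx[t [ut tI te]] us sI.
have stI : {in undup (s ++ t), forall i, I i}.
  by move=> i; rewrite mem_undup mem_cat => /orP[/sI|/tI].
exists (undup (s ++ t)); split; [exact: undup_uniq|exact: stI| |].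
  by move=> i si; rewrite mem_undup mem_cat si.
have ts : {subset t <= undup (s ++ t)}.
  by move=> i ti; rewrite mem_undup mem_cat ti orbT.
exact: le_lt_trans (fourier_mono ut (undup_uniq _) ts stI hx) te.
Qed.

Lemma hnormZ x (a : R) : HH p x -> hnorm p (a *: x) = `|a| * hnorm p x.
Proof.
move=> hx; have hax := HHZ hp a hx; have h0 := HH00.
have E w : HH p w -> ip p (a *: x) w = a * ip p x w.
  by move=> hw; rewrite -[a *: x]addr0 (ip_lin hp a hx h0 hw) ip0l// addr0.
by rewrite /hnorm E// ip_sym E// mulrA -expr2 sqrtrM ?sqr_ge0// sqrtr_sqr.
Qed.

Lemma lin_bound (a e r r' : R) : 0 <= r -> r < e / 2 / (`|a| + 1) ->
  r' < e / 2 -> `|a| * r + r' < e.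
Proof.
move=> r0; rewrite ltr_pdivlMr ?ltr_wpDl// mulrDr mulr1 [X in X + _ < _]mulrC; lra.
Qed.

Lemma closed_span_lin x y (a : R) : F x -> F y -> F (a *: x + y).
Proof.
move=> Fx Fy; have hx := closed_span_HH Fx; have hy := closed_span_HH Fy.
apply: closed_span_closed; first exact: HH_lin.
move=> e e0; have a0 : 0 < `|a| + 1 by rewrite ltr_wpDl.
have e1 : 0 < e / 2 / (`|a| + 1) by rewrite !divr_gt0.
have e2 : 0 < e / 2 by rewrite divr_gt0.
have [s [us sI _ sx]] := span_approx Fx e1 (isT : uniq [::]) ltac:(by []).
have [t [ut tI st ty]] := span_approx Fy e2 us sI.
have [u [v [hu hv xu yv Fuv]]] : exists u v, [/\ HH p u, HH p v,
    hnorm p (x - u) < e / 2 / (`|a| + 1), hnorm p (y - v) < e / 2 & F (a *: u + v)].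
  exists (fourier t x), (fourier t y); split; [exact: fourier_HH|exact: fourier_HH| |exact: ty|].
    exact: le_lt_trans (fourier_mono us ut st tI hx) sx.
  have -> : a *: fourier t x + fourier t y = lincomb phi t (fun i => a * coef x i + coef y i).
    rewrite /fourier /lincomb scaler_sumr -big_split; apply: eq_bigr => i _ /=.
    by rewrite scalerA scalerDl.
  exact: lincomb_span.
exists (a *: u + v) => //.
have -> : a *: x + y - (a *: u + v) = a *: (x - u) + (y - v).
  by rewrite scalerBr opprD addrACA.
have hxB := HHB hp hx hu; have hyB := HHB hp hy hv.
apply: le_lt_trans (hnormD hp (HHZ hp a hxB) hyB) _; rewrite (hnormZ a hxB).
exact: lin_bound (hnorm_ge0 p (x - u)) xu yv.
Qed.

Lemma closed_span0 : F 0.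
Proof.
by have := @lincomb_span [::] (fun=> 0) (fun _ => ltac:(by [])); rewrite /lincomb big_nil.
Qed.

Let Hlin a x y : HH p x -> HH p y -> HH p (a *: x + y) := HH_lin hp a.
Let Hiplin a x y z hx hy hz := @ip_lin _ p hp x y z a hx hy hz.

Lemma span_projection x : HH p x ->
  exists2 y, F y & forall z, F z -> ip p (x - y) z = 0.
Proof.
exact: (@projection_exists R (preHH R) (HH p) F (ip p) Hlin (@ip_sym _ p) Hiplin
  (@ip_ge0 _ p hp) (@ip_le_hnorm _ p hp) (@hnormD _ p hp) hs.2
  closed_span_HH closed_span0 (fun a x y => @closed_span_lin x y a) closed_span_closed).
Qed.

Local Notation sp := (spectral_proj p phi I).

Lemma spectral_projP x : HH p x ->
  F (sp x) /\ forall z, F z -> ip p (x - sp x) z = 0.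
Proof.
move=> /span_projection[y Fy xy].
exact (@xgetPex _ 0 [set y | F y /\ forall z, F z -> ip p (x - y) z = 0]
  (ex_intro _ y (conj Fy xy))).
Qed.

Lemma spectral_proj_span x : HH p x -> F (sp x).
Proof. by case/spectral_projP. Qed.

Lemma spectral_proj_HH x : HH p x -> HH p (sp x).
Proof. by move=> /spectral_proj_span/closed_span_HH. Qed.

Lemma ip_spectral_proj x z : HH p x -> F z -> ip p (sp x) z = ip p x z.
Proof.
move=> hx Fz; have [_ /(_ z Fz)] := spectral_projP hx.
rewrite (ip_subl hp hx (spectral_proj_HH hx) (closed_span_HH Fz)) => /eqP.
by rewrite subr_eq0 => /eqP ->.
Qed.

Lemma spanB x y : F x -> F y -> F (x - y).
Proof. by move=> Fx Fy; have := closed_span_lin (-1) Fy Fx; rewrite scaleN1r addrC. Qed.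

Lemma span_ip_eq x y : F x -> F y -> (forall z, F z -> ip p x z = ip p y z) ->
  eqHH p x y.
Proof.
move=> Fx Fy xy; have Hx := closed_span_HH Fx; have Hy := closed_span_HH Fy.
apply: (ip_null_eqHH hp hs Hx Hy).
rewrite (ip_subl hp Hx Hy (HHB hp Hx Hy)) (xy _ (spanB Fx Fy)).
exact: subrr.
Qed.

Lemma eqHH_ip x y z : HH p x -> HH p y -> HH p z -> eqHH p x y ->
  ip p x z = ip p y z.
Proof.
move=> hx hy hz xy; apply/eqP; rewrite -subr_eq0 -(ip_subl hp hx hy hz) ip_sym.
by rewrite (ip_null hp hz (HHB hp hx hy) (eqHH_ip_null hp hs hx hy xy)).
Qed.

Lemma eqHH_sym x y : HH p x -> HH p y -> eqHH p x y -> eqHH p y x.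
Proof.
move=> hx hy xy; apply: (ip_null_eqHH hp hs hy hx).
rewrite -(ip_opp p (y - x)) opprB; exact: (eqHH_ip_null hp hs hx hy xy).
Qed.

Lemma spectral_proj_id x : F x -> eqHH p (sp x) x.
Proof.
move=> Fx; have hx := closed_span_HH Fx.
by apply: (span_ip_eq (spectral_proj_span hx) Fx) => z; exact: ip_spectral_proj.
Qed.

Lemma spectral_rangeP x : spectral_range p phi I x <-> F x.
Proof.
split=> [[hx [y hy xy]]|Fx].
  have Fy := spectral_proj_span hy.
  exact: closed_span_eqHH Fy hx (eqHH_sym hx (closed_span_HH Fy) xy).
have hx := closed_span_HH Fx; split=> //; exists x => //.
exact: eqHH_sym (spectral_proj_HH hx) hx (spectral_proj_id Fx).
Qed.

Lemma spectral_proj_le x : HH p x -> hnorm p (sp x) <= hnorm p x.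
Proof.
move=> hx; have Fx := spectral_proj_span hx; have hsx := closed_span_HH Fx.
have := ip_ge0 hp (HHB hp hx hsx).
have := ip_spectral_proj hx Fx; move: (sp x) hsx {Fx} => y hy E.
have hB := HHB hp hx hy => h; apply: (hnorm_le hy hx); move: h.
rewrite (ip_subl hp hx hy hB) (ip_sym p x (x - y)) (ip_sym p y (x - y)).
rewrite (ip_subl hp hx hy hx) (ip_subl hp hx hy hy) (ip_sym p y x) E; lra.
Qed.

Local Notation rep := (represents F (ip p) (@projP R)).

Let rep_lin a g h x y :=
  @represents_lin _ _ (HH p) F (ip p) Hiplin closed_span_HH _ (@HH_projP _ p hp)
    (fun a x y => projP_lin x y a) a g h x y.

Let rep_le g x := @represents_le _ _ (HH p) F (ip p) Hlin (@ip_sym _ p) Hiplin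
  (@ip_ge0 _ p hp) closed_span_HH _ (@HH_projP _ p hp) (@ip_projPP _ p hp) g x.

Lemma compressP_span x : HH p x -> F (compressP p phi I x).
Proof. by move=> hx; exact/spectral_proj_span/HH_projP/spectral_proj_HH. Qed.

Lemma compressP_proj x z : HH p x -> F z ->
  ip p (projP (sp x)) z = ip p (compressP p phi I x) z.
Proof.
move=> hx Fz; rewrite (ip_spectral_proj _ Fz)//.
exact: HH_projP (spectral_proj_HH hx).
Qed.

Lemma compressP_represents x : F x -> rep (compressP p phi I x) x.
Proof.
move=> Fx z Fz; have hx := closed_span_HH Fx; have hz := closed_span_HH Fz.
rewrite -compressP_proj// (ip_projP_sym hp hx hz).
rewrite (ip_projP_sym hp (spectral_proj_HH hx) hz).
exact/esym/(eqHH_ip (spectral_proj_HH hx) hx (HH_projP hp hz))/spectral_proj_id.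
Qed.

Lemma represents_unique g g' x : F g -> F g' -> rep g x -> rep g' x -> eqHH p g g'.
Proof.
by move=> Fg Fg' gx gx'; apply: (span_ip_eq Fg Fg') => z Fz; rewrite -gx// gx'.
Qed.

Variables (lam : int -> R) (e m k : R).
Hypotheses (e1 : `|e| = 1) (m0 : 0 < m) (k0 : 0 < k)
  (lam_m : forall i, I i -> m <= e * lam i)
  (eig : forall i j, I i -> I j -> (lam i + lam j) * ip p (projP (phi i)) (phi j) =
    lam j * ip p (phi i) (phi j) + hform p (phi i).1 (phi j).1)
  (hk : forall x, HH p x -> `|hform p x.1 x.1| <= k * ip p (projP x) x).

Let Gm i j := ip p (projP (phi i)) (phi j).
Let Hm i j := e * hform p (phi i).1 (phi j).1.
Let mu i := e * lam i.

Lemma lincomb_bform (Q : preHH R -> preHH R -> R) s b c :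
  (forall u v, Q u v = Q v u) ->
  (forall a u v w, HH p u -> HH p v -> HH p w ->
    Q (a *: u + v) w = a * Q u w + Q v w) ->
  {in s, forall i, I i} ->
  Q (lincomb phi s b) (lincomb phi s c) =
  bform s (fun i j => Q (phi i) (phi j)) b c.
Proof.
move=> QC Ql sI; rewrite (lincomb_bilinear b Ql sI (lincomb_HH c sI)).
apply: eq_big_seq => i si; rewrite QC (lincomb_bilinear c Ql sI (phiHH (sI i si))).
rewrite mulr_sumr; apply: eq_bigr => j _; rewrite QC; ring.
Qed.

Lemma bform_projP s b c : {in s, forall i, I i} ->
  bform s Gm b c = ip p (projP (lincomb phi s b)) (lincomb phi s c).
Proof.
move=> sI; pose Q x y := cform p x.1 y.1.
have QE x y : HH p x -> HH p y -> ip p (projP x) y = Q x y by exact: ip_projP.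
rewrite (QE _ _ (lincomb_HH b sI) (lincomb_HH c sI)) (@lincomb_bform Q s b c)//.
- by apply: eq_bform => // i j si sj; rewrite /Gm QE//; apply/phiHH/sI.
- by move=> u v; exact: cformC.
- by move=> a u v w [hu _] [hv _] [hw _]; exact: (cform_lin hp a hu hv hw).
Qed.

Lemma bform_hform s b : {in s, forall i, I i} ->
  bform s Hm b b = e * hform p (lincomb phi s b).1 (lincomb phi s b).1.
Proof.
move=> sI; rewrite bformZ; congr (_ * _); apply/esym.
apply: (@lincomb_bform (fun x y => hform p x.1 y.1) s b b) => //.
  by move=> u v; exact: hformC.
by move=> a u v w [hu _] [hv _] [hw _]; exact: (hform_lin hp a hu hv hw).
Qed.

Section FiniteSection.
Variables (s : seq int) (us : uniq s) (sI : {in s, forall i, I i}).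

Let mum : {in s, forall i, m <= mu i}. Proof. by move=> i /sI/lam_m. Qed.

Let b0 : {in s, forall i, 0 <= ip p (phi i) (phi i)}.
Proof. by move=> i /sI/phi_gt0/ltW. Qed.

Let Gsym : {in s &, forall i j, Gm i j = Gm j i}.
Proof.
by move=> i j /sI/phiHH hi /sI/phiHH hj; rewrite /Gm (ip_projP_sym hp hi hj) ip_sym.
Qed.

Let kG : {in s &, forall i j, (mu i + mu j) * Gm i j =
  mu j * (ip p (phi i) (phi i) *+ (i == j)) + Hm i j}.
Proof.
move=> i j /sI Ii /sI Ij; rewrite /mu -mulrDr -mulrA eig// mulrDr mulrA.
congr (_ * _ + _); have [<-|ij] := eqVneq i j; first by rewrite mulr1n.
by rewrite mulr0n phi_orth.
Qed.

Let HG b : `|bform s Hm b b| <= k * bform s Gm b b.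
Proof.
by rewrite bform_hform// bform_projP// normrM e1 mul1r; exact/hk/lincomb_HH.
Qed.

Let Gb b : bform s Gm b b <= wnorm s nsq b.
Proof.
by rewrite bform_projP// -lincomb_norm//; exact/(ip_projP_le hp)/lincomb_HH.
Qed.

Lemma lincomb_lower_bound b g : F g -> rep g (lincomb phi s b) ->
  ip p (lincomb phi s b) (lincomb phi s b) <= lower_cst m k * ip p g g.
Proof.
move=> Fg gb; have hg := closed_span_HH Fg.
rewrite lincomb_norm//; apply: (@le_trans _ _ (lower_cst m k * wnorm s nsq (coef g))).
  apply: (bform_lower_bound us m0 k0 mum b0 Gsym kG HG Gb) => i si.
  have hi := phiHH (sI si); rewrite mulrC divfK ?gt_eqF ?phi_gt0//; last exact: sI.
  rewrite -(gb _ (phi_span (sI si))) (ip_projP_sym hp (lincomb_HH b sI) hi).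
  rewrite (ip_lincombl b sI (HH_projP hp hi)); apply: eq_big_seq => j sj.
  by rewrite mulrC /Gm ip_sym.
rewrite -(lincomb_norm (coef g) us sI); apply: ler_wpM2l; last exact: bessel.
have k2 : 0 <= k ^+ 2 by exact: sqr_ge0.
have k4 : 0 <= k ^+ 4 by rewrite exprn_ge0// ltW.
by rewrite /lower_cst !(addr_ge0, mulr_ge0, divr_ge0, invr_ge0, exprn_ge0)// ltW.
Qed.

Lemma lincomb_defect b c t : 0 < t ->
  `|ip p (projP (lincomb phi s b)) (lincomb phi s c)
    - ip p (lincomb phi s b) (lincomb phi s c) / 2| <=
  k / 4 * (t * (ip p (lincomb phi s b) (lincomb phi s b) / m)
    + hnegsq s nsq mu c / t).
Proof.
move=> t0; have := defect_le2 us m0 k0 mum Gsym kG HG Gb b c t0.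
have -> : bform s (defect Gm nsq) b c =
    ip p (projP (lincomb phi s b)) (lincomb phi s c)
    - ip p (lincomb phi s b) (lincomb phi s c) / 2.
  rewrite -bform_projP// (ip_lincombl b sI (lincomb_HH c sI)).
  have -> : \sum_(i <- s) b i * ip p (phi i) (lincomb phi s c) =
      bform s (fun i j => nsq i *+ (i == j)) b c.
    rewrite bform_diag//; apply: eq_big_seq => i si.
    by rewrite ip_sym ip_lincomb_phi//; ring.
  rewrite mulrC -mulNr -bformZ -bformD; apply: eq_bform => // i j _ _.
  by rewrite /defect mulNr [_ / 2]mulrC.
move/le_trans; apply; rewrite ler_wpM2l ?divr_ge0 ?(ltW k0)// lerD2r ler_wpM2l ?(ltW t0)//.
rewrite lincomb_norm// /hnegsq /wnorm mulr_suml !big_seq; apply: ler_sum => i si.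
rewrite [leRHS]mulrAC ler_wpM2r ?sqr_ge0// ler_wpM2l ?b0// lef_pV2 ?posrE ?mum//.
exact: lt_le_trans (mum si).
Qed.

End FiniteSection.

Definition inv_cst : R := Num.sqrt (lower_cst m k).

Lemma inv_cst_ge1 : 1 <= inv_cst.
Proof.
rewrite -[1]sqrtr1 /inv_cst ler_wsqrtr// /lower_cst.
have : 0 <= 4 * (4 * k ^+ 2 + k ^+ 4 / m ^+ 2) / m ^+ 2.
  by rewrite !(addr_ge0, mulr_ge0, divr_ge0, invr_ge0, exprn_ge0)// ltW.
by lra.
Qed.

Lemma represents_lower g x : F g -> F x -> rep g x ->
  hnorm p x <= inv_cst * hnorm p g.
Proof.
move=> Fg Fx gx; have hx := closed_span_HH Fx; have hg := closed_span_HH Fg.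
have C1 := inv_cst_ge1; have C0 : 0 < inv_cst by exact: lt_le_trans C1.
apply/ler_addgt0Pr => r r0.
have r1 : 0 < r / (1 + inv_cst) by rewrite divr_gt0// addr_gt0.
have [y [Fy xy ylow]] : exists y, [/\ F y, hnorm p (x - y) < r / (1 + inv_cst) &
    forall h, F h -> rep h y -> hnorm p y <= inv_cst * hnorm p h].
  have [_ /(_ _ r1)[s [us sI xs]]] := (closed_spanP x).1 Fx.
  exists (fourier s x); split; [exact: fourier_span|exact: xs|move=> h Fh hh].
  have lb := lincomb_lower_bound us sI Fh hh.
  have c0 : 0 <= lower_cst m k.
    by apply: ltW; rewrite -sqrtr_gt0.
  by rewrite /hnorm /inv_cst -sqrtrM//; apply: ler_wsqrtr; exact: lb.
have hy := closed_span_HH Fy; have hxy := HHB hp hx hy.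
have Fh := compressP_span hy; have hrep := compressP_represents Fy.
have := ylow _ Fh hrep; move: (compressP p phi I y) Fh hrep => h Fh hrep yh.
have hh := closed_span_HH Fh.
have ghxy : rep (g - h) (x - y).
  have := rep_lin (-1) Fh Fg Fy Fx hrep gx.
  by rewrite !scaleN1r ![- _ + _]addrC.
have gh : hnorm p (g - h) <= hnorm p (x - y).
  apply: (hnorm_le (HHB hp hg hh) hxy).
  exact: le_trans (rep_le (spanB Fg Fh) (spanB Fx Fy) ghxy) (ip_projP_le hp hxy).
have xE : hnorm p x <= hnorm p (x - y) + hnorm p y.
  by have := hnormD hp hxy hy; rewrite subrK.
have hE : hnorm p h <= hnorm p g + hnorm p (x - y).
  have := hnormD hp hg (HHB hp hh hg); rewrite addrC subrK => /le_trans; apply.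
  by rewrite lerD2l -hnormN opprB.
apply: le_trans xE _.
have : inv_cst * hnorm p h <= inv_cst * (hnorm p g + hnorm p (x - y)).
  by rewrite ler_wpM2l// ltW.
have : hnorm p (x - y) * (1 + inv_cst) <= r.
  by rewrite -ler_pdivlMr ?addr_gt0//; exact: ltW.
by move: yh; set u := hnorm p y; set v := hnorm p (x - y); lra.
Qed.

Lemma represents_solution y : F y -> exists2 x, F x & rep y x.
Proof.
exact: (@weak_solution R (preHH R) (HH p) F (ip p) Hlin (@ip_sym _ p) Hiplin
  (@ip_ge0 _ p hp) (@ip_le_hnorm _ p hp) (@hnormD _ p hp) hs.2
  closed_span_HH closed_span0 (fun a x y => @closed_span_lin x y a) closed_span_closed
  _ (@HH_projP _ p hp) (fun a x y => projP_lin x y a) (@ip_projPP _ p hp)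
  (@ip_projP_le _ p hp) _ inv_cst_ge1 represents_lower y).
Qed.

Lemma compressP_eqHH y x : F y -> F x -> rep y x -> eqHH p (compressP p phi I x) y.
Proof.
move=> Fy Fx yx; have hx := closed_span_HH Fx.
exact: represents_unique (compressP_span hx) Fy (compressP_represents Fx) yx.
Qed.

Lemma compressP_invertible : invertible_compressP p phi I.
Proof.
split.
- move=> x /spectral_rangeP/closed_span_HH/compressP_span Fg.
  exact/spectral_rangeP.
- move=> x y /spectral_rangeP Fx /spectral_rangeP Fy xy.
  have hx := closed_span_HH Fx; have hy := closed_span_HH Fy.
  have Fgx := compressP_span hx; have Fgy := compressP_span hy.
  have := rep_lin (-1) Fgy Fgx Fy Fx (compressP_represents Fy) (compressP_represents Fx).
  rewrite !scaleN1r ![- _ + _]addrC => W.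
  have := represents_lower (spanB Fgx Fgy) (spanB Fx Fy) W.
  have -> : hnorm p (compressP p phi I x - compressP p phi I y) = 0.
    rewrite /hnorm (eqHH_ip_null hp hs (closed_span_HH Fgx) (closed_span_HH Fgy) xy).
    exact: sqrtr0.
  rewrite mulr0 => n0; apply: (ip_null_eqHH hp hs hx hy).
  rewrite -(hnorm_sq hp (HHB hp hx hy)).
  have /eqP -> : hnorm p (x - y) == 0 by rewrite eq_le n0 hnorm_ge0.
  by rewrite expr0n.
- move=> y /spectral_rangeP Fy; have [x Fx yx] := represents_solution Fy.
  exists x; first exact/spectral_rangeP.
  exact: compressP_eqHH.
- exists inv_cst => x /spectral_rangeP Fx.
  exact: represents_lower (compressP_span (closed_span_HH Fx)) Fx (compressP_represents Fx).
Qed.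

Local Notation B := (opB p phi I).

Lemma opBP x : HH p x -> F (B x) /\ rep (sp x) (B x).
Proof.
move=> hx; have Fs := spectral_proj_span hx.
have [y Fy sy] := represents_solution Fs.
have : exists y, spectral_range p phi I y /\ eqHH p (compressP p phi I y) (sp x).
  by exists y; split; [exact/spectral_rangeP|exact: compressP_eqHH].
move=> /(@xgetPex _ 0 [set y | spectral_range p phi I y /\ eqHH p (compressP p phi I y) (sp x)]).
rewrite /opB /compressP_inv; set w := xget _ _ => -[/spectral_rangeP Fw ws].
have hw := closed_span_HH Fw; clearbody w.
split; first exact: spectral_proj_span.
move=> z Fz; rewrite (compressP_proj hw Fz).
exact: eqHH_ip (closed_span_HH (compressP_span hw)) (closed_span_HH Fs) (closed_span_HH Fz) ws.
Qed.

Lemma opB_le x : HH p x -> hnorm p (B x) <= inv_cst * hnorm p (sp x).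
Proof.
by move=> hx; have [FB xB] := opBP hx; exact: represents_lower (spectral_proj_span hx) FB xB.
Qed.

Lemma opB_selfadjoint : selfadjoint_bounded p B.
Proof.
have C0 : 0 <= inv_cst by rewrite sqrtr_ge0.
split.
- by move=> x /opBP[/closed_span_HH].
- move=> x y hx hy; have [Fa xa] := opBP hx; have [Fb yb] := opBP hy.
  have ha := closed_span_HH Fa; have hb := closed_span_HH Fb.
  rewrite ip_sym -(ip_spectral_proj hy Fa) -(yb _ Fa) (ip_projP_sym hp hb ha) ip_sym.
  by rewrite (xa _ Fb) (ip_spectral_proj hx Fb).
- exists inv_cst => x hx; apply: le_trans (opB_le hx) _.
  by rewrite ler_wpM2l// spectral_proj_le.
Qed.

Definition half_sum s x : R :=
  \sum_(i <- s) mu i * ip p (phi i) x ^+ 2 / ip p (phi i) (phi i).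

Lemma defect_approx (a a' c c' u r K : R) : `|a - a'| <= u -> `|c - c'| <= u ->
  `|a' - c' / 2| <= K -> u <= r / 2 -> `|a - c / 2| <= K + r.
Proof.
rewrite !ler_norml => /andP[? ?] /andP[? ?] /andP[? ?] ur.
by apply/andP; split; lra.
Qed.

Lemma span_norm_half_sum x K : F x -> 
  (forall s, uniq s -> {in s, forall i, I i} -> half_sum s x <= K) ->
  ip p x x <= K / m.
Proof.
move=> Fx sK; have hx := closed_span_HH Fx.
apply/ler_addgt0Pr => r r0.
have sr : 0 < Num.sqrt r by rewrite sqrtr_gt0.
have [_ /(_ _ sr)[s [us sI xs]]] := (closed_spanP x).1 Fx.
have hP := fourier_HH x sI.
rewrite (pythagoras hx hP); last first.
  by rewrite (ip_subl hp hx hP hP) fourier_norm// subrr.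
rewrite addrC lerD//.
  rewrite fourier_normE// ler_pdivlMr// mulrC mulr_sumr.
  apply: le_trans (sK s us sI); rewrite /half_sum !big_seq; apply: ler_sum => i si.
  rewrite [ip p x _]ip_sym -[leRHS]mulrA ler_wpM2r//.
    by rewrite divr_ge0 ?sqr_ge0// ltW// phi_gt0//; exact: sI.
  exact/lam_m/sI.
rewrite -(hnorm_sq hp (HHB hp hx hP)) -[leRHS](sqr_sqrtr (ltW r0)).
by rewrite ler_sqr ?nnegrE ?sqrtr_ge0 ?hnorm_ge0//; exact: ltW.
Qed.

(* The truncation [z] of [|lam| y] is used as a test vector; the defect is
   smoothing by [lincomb_defect], so only [hnorm y] enters besides [x]. *)
Lemma half_sum_le s x y : uniq s -> {in s, forall i, I i} -> F x -> F y ->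
  rep x y -> half_sum s y <= 8 * half_sum s x + 2 * k ^+ 2 / m * ip p y y.
Proof.
move=> us sI Fx Fy xy; have hx := closed_span_HH Fx; have hy := closed_span_HH Fy.
pose c i := mu i * coef y i.
pose z := lincomb phi s c.
have Fz : F z by exact: lincomb_span.
have hz := closed_span_HH Fz.
have yz : ip p y z = half_sum s y.
  rewrite ip_sym ip_lincombl//; apply: eq_bigr => i _.
  by rewrite /c /coef [ip p y _]ip_sym expr2; ring.
have Nz : hnegsq s nsq mu c = half_sum s y.
  apply: eq_big_seq => i /sI Ii; rewrite /c /coef [ip p y _]ip_sym; field.
  by rewrite !gt_eqF ?phi_gt0// (lt_le_trans m0)// lam_m.
have xz : ip p x z <= half_sum s y / 8 + 2 * half_sum s x.
  rewrite ip_sym ip_lincombl// /half_sum mulr_suml mulr_sumr -big_split /=.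
  rewrite !big_seq; apply: ler_sum => i /sI Ii.
  have hb : 0 <= mu i / ip p (phi i) (phi i).
    by rewrite divr_ge0 ?(ltW (phi_gt0 Ii))// (le_trans (ltW m0))// lam_m.
  rewrite /c /coef [ip p y _]ip_sym.
  apply: le_trans (_ : _ <= mu i / nsq i * ip p (phi i) y ^+ 2 / 8 +
    2 * (mu i / nsq i * ip p (phi i) x ^+ 2)) _; last first.
    by rewrite le_eqVlt; apply/orP; left; apply/eqP; ring.
  have := mulr_ge0 hb (sqr_ge0 (ip p (phi i) y - 4 * ip p (phi i) x)).
  move: (ip p (phi i) y) (ip p (phi i) x) (mu i) (nsq i) => u v w n; lra.
have bound : `|ip p (projP y) z - ip p y z / 2| <=
    k / 4 * (2 * k * (ip p y y / m) + hnegsq s nsq mu c / (2 * k)).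
  apply/ler_addgt0Pr => r r0; have n0 := hnorm_ge0 p z.
  have r1 : 0 < r / (2 * (hnorm p z + 1)) by rewrite divr_gt0// mulr_gt0// ltr_wpDl.
  have k20 : 0 < 2 * k by rewrite mulr_gt0.
  have [w [hw yw wb]] : exists w, [/\ HH p w, hnorm p (y - w) < r / (2 * (hnorm p z + 1)) &
      `|ip p (projP w) z - ip p w z / 2| <=
      k / 4 * (2 * k * (ip p y y / m) + hnegsq s nsq mu c / (2 * k))].
    have [t [ut tI st yt]] := span_approx Fy r1 us sI.
    exists (fourier t y); split; [exact: fourier_HH|exact: yt|].
    have := lincomb_defect ut tI (coef y) (fun i => if i \in s then c i else 0) k20.
    rewrite -(lincomb_extend c us ut st).
    have -> : hnegsq t nsq mu (fun i => if i \in s then c i else 0) = hnegsq s nsq mu c.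
      rewrite /hnegsq /wnorm.
      rewrite (eq_bigr (fun i => if i \in s then nsq i / mu i * c i ^+ 2 else 0)); last first.
        by move=> i _; case: ifP => // _; rewrite expr0n mulr0.
      rewrite -big_mkcond -big_filter; apply: perm_big; apply: uniq_perm => //.
        exact: filter_uniq.
      by move=> i; rewrite mem_filter; case: (boolP (i \in s)) => // /st->.
    move/le_trans; apply; rewrite ler_wpM2l ?divr_ge0 ?(ltW k0)// lerD2r.
    apply: ler_wpM2l; first exact: ltW.
    by apply: ler_wpM2r; [rewrite invr_ge0 ltW|exact: bessel].
  have hyw := HHB hp hy hw.
  have d1 := ip_le_hnorm hp (HH_projP hp hyw) hz.
  have d2 := ip_le_hnorm hp hyw hz.
  have Pyw : ip p (projP (y - w)) z = ip p (projP y) z - ip p (projP w) z.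
    rewrite -(ip_subl hp (HH_projP hp hy) (HH_projP hp hw) hz).
    by rewrite [y - w]addrC -scaleN1r projP_lin scaleN1r addrC.
  rewrite Pyw in d1; rewrite (ip_subl hp hy hw hz) in d2.
  have {}d1 := le_trans d1 (ler_wpM2r n0 (hnorm_projP hp hyw)).
  have ur : hnorm p (y - w) * hnorm p z <= r / 2.
    have h := hnorm_ge0 p (y - w).
    have := ltW yw; rewrite ler_pdivlMr; last by rewrite mulr_gt0// ltr_wpDl.
    by move: h n0; set u := hnorm p (y - w); set v := hnorm p z; lra.
  exact: defect_approx d1 d2 wb ur.
rewrite (xy z Fz) yz Nz ler_norml in bound; case/andP: bound => + _.
have -> : k / 4 * (2 * k * (ip p y y / m) + half_sum s y / (2 * k)) =
    k ^+ 2 / m * ip p y y / 2 + half_sum s y / 8.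
  by field; rewrite !gt_eqF.
have -> : 2 * k ^+ 2 / m * ip p y y = 4 * (k ^+ 2 / m * ip p y y / 2) by field; rewrite gt_eqF.
move: xz; move: (k ^+ 2 / m * ip p y y / 2) => u; lra.
Qed.

Hypotheses (phiHH0 : forall i, i != 0 -> HH p (phi i))
  (I_neq0 : forall i, I i -> i != 0)
  (phi_orth0 : forall i j, i != 0 -> I j -> i != j -> ip p (phi i) (phi j) = 0).

Lemma span_orth x y : HH p x -> (forall i, I i -> ip p x (phi i) = 0) -> F y ->
  ip p x y = 0.
Proof.
move=> hx xI Fy; have hy := closed_span_HH Fy; apply/eqP; rewrite -normr_le0.
apply/ler_addgt0Pr => r r0; rewrite add0r; have n0 := hnorm_ge0 p x.
have r1 : 0 < r / (hnorm p x + 1) by rewrite divr_gt0// ltr_wpDl.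
have [_ /(_ _ r1)[s [us sI ys]]] := (closed_spanP y).1 Fy.
have hP := fourier_HH y sI; have hB := HHB hp hy hP.
have -> : ip p x y = ip p x (y - fourier s y).
  rewrite ip_sym [RHS]ip_sym (ip_subl hp hy hP hx) ip_lincombl// big1_seq ?subr0//.
  by move=> i /andP[_ si]; rewrite ip_sym xI ?mulr0//; exact: sI.
apply: le_trans (ip_le_hnorm hp hx hB) _.
have := ltW ys; rewrite ler_pdivlMr ?ltr_wpDl// => /(le_trans _); apply.
rewrite mulrC ler_wpM2l ?hnorm_ge0// lerDl; exact: ler01.
Qed.

Definition half_energy x : \bar R := \esum_(i in [set i : int | i != 0])
  (`|lam i| `^ (2 * 2^-1) * ip p (phi i) x ^+ 2 / hnorm p (phi i) ^+ 2)%:E.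

Let term i x := `|lam i| `^ (2 * 2^-1) * ip p (phi i) x ^+ 2 / hnorm p (phi i) ^+ 2.

Let termE i x : I i -> term i x = mu i * ip p (phi i) x ^+ 2 / ip p (phi i) (phi i).
Proof.
move=> Ii; rewrite /term (hnorm_sq hp (phiHH Ii)) mulfV// powRr1//.
have mu0 : 0 <= mu i by rewrite (le_trans (ltW m0))// lam_m.
by rewrite -[mu i]ger0_norm// normrM e1 mul1r.
Qed.

Let term0 i x : i != 0 -> ~ I i -> F x -> term i x = 0.
Proof.
move=> i0 nI Fx; rewrite /term (span_orth (phiHH0 i0) _ Fx) ?expr0n ?mulr0 ?mul0r//.
by move=> j Ij; apply: phi_orth0 => //; apply/eqP => ij; apply: nI; rewrite ij.
Qed.

Let term_ge0 i x : 0 <= term i x.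
Proof. by rewrite divr_ge0 ?sqr_ge0// mulr_ge0 ?powR_ge0 ?sqr_ge0. Qed.

Lemma half_sum_energy s x : uniq s -> {in s, forall i, I i} ->
  ((half_sum s x)%:E <= half_energy x)%E.
Proof.
move=> us sI; apply: esum_ge; exists [set` s].
  by split; [exact: finite_seq|move=> i /= /sI/I_neq0].
rewrite -fsbig_seq// sumEFin lee_fin le_eqVlt; apply/orP; left; apply/eqP.
by apply: eq_big_seq => i /sI Ii; rewrite -/(term i x) termE.
Qed.

Lemma half_energy_le x (K : R) : F x ->
  (forall s, uniq s -> {in s, forall i, I i} -> half_sum s x <= K) ->
  (half_energy x <= K%:E)%E.
Proof.
move=> Fx sK; apply: ge_ereal_sup => _ [D [/finite_seqP[t tD] D0] <-].
have {}tD : D = [set` undup t].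
  by rewrite tD; apply/seteqP; split=> i /=; rewrite mem_undup.
rewrite tD -fsbig_seq ?undup_uniq// sumEFin lee_fin.
have tn0 i : i \in undup t -> i != 0 by move=> ti; apply: D0; rewrite tD.
move: (undup t) (undup_uniq t) tn0 => {D0 D tD} t ut t0.
pose s := [seq i <- t | `[< I i >]].
have sI : {in s, forall i, I i} by move=> i; rewrite mem_filter => /andP[/asboolP].
apply: le_trans (sK s (filter_uniq _ ut) sI).
rewrite /half_sum big_filter (bigID (fun i => `[< I i >]))/= [X in _ + X]big1_seq ?addr0.
  by apply: ler_sum => i /asboolP Ii; rewrite -/(term i x) termE.
move=> i /andP[/asboolP nI ti].
by rewrite -/(term i x) term0//; exact: t0.
Qed.

Definition energy_cst : R := 8 + 2 * k ^+ 2 / m * (inv_cst ^+ 2 / m).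

Lemma energy_cst_gt0 : 0 < energy_cst.
Proof.
have : 0 <= 2 * k ^+ 2 / m * (inv_cst ^+ 2 / m).
  by rewrite !(mulr_ge0, divr_ge0, invr_ge0, exprn_ge0, sqrtr_ge0)// ltW.
by rewrite /energy_cst; lra.
Qed.

Lemma half_energy_ge0 x : (0 <= half_energy x)%E.
Proof. by apply: esum_ge0 => i _; rewrite lee_fin; exact: term_ge0. Qed.

Lemma represents_half_energy x y : F x -> F y -> rep x y ->
  (half_energy y <= energy_cst%:E * half_energy x)%E.
Proof.
move=> Fx Fy xy; have hx := closed_span_HH Fx; have hy := closed_span_HH Fy.
case: (ltP (half_energy x) +oo%E) => [fin|]; last first.
  rewrite leye_eq => /eqP ->; rewrite gt0_muley ?leey//.
  rewrite lte_fin; exact: energy_cst_gt0.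
have /fineK aE : half_energy x \is a fin_num by rewrite ge0_fin_numE ?half_energy_ge0.
rewrite -aE -EFinM; move: (fine _) aE => a aE.
have sa s : uniq s -> {in s, forall i, I i} -> half_sum s x <= a.
  by move=> us sI; have := half_sum_energy x us sI; rewrite -aE lee_fin.
have n1 := span_norm_half_sum Fx sa.
have n2 : ip p y y <= inv_cst ^+ 2 * ip p x x.
  rewrite -!(hnorm_sq hp)// -exprMn ler_sqr ?nnegrE ?mulr_ge0 ?hnorm_ge0 ?sqrtr_ge0//.
  exact: represents_lower.
apply: (half_energy_le Fy) => s us sI.
apply: le_trans (half_sum_le us sI Fx Fy xy) _.
have km : 0 <= 2 * k ^+ 2 / m by rewrite divr_ge0 ?mulr_ge0 ?sqr_ge0// ltW.
have n3 : 2 * k ^+ 2 / m * ip p y y <=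
    2 * k ^+ 2 / m * (inv_cst ^+ 2 * (a / m)).
  by rewrite ler_wpM2l// (le_trans n2)// ler_wpM2l ?sqr_ge0.
have n4 : 8 * half_sum s x <= 8 * a by rewrite ler_wpM2l// sa.
apply: le_trans (lerD n4 n3) _.
by rewrite le_eqVlt /energy_cst; apply/orP; left; apply/eqP; field; rewrite gt_eqF.
Qed.

Lemma represents_alpha_norm x y : F x -> F y -> rep x y ->
  (alpha_norm p lam phi 2^-1 y <=
   (energy_cst `^ 2^-1)%:E * alpha_norm p lam phi 2^-1 x)%E.
Proof.
move=> Fx Fy xy; have c0 : (0 <= energy_cst%:E)%E by rewrite lee_fin ltW ?energy_cst_gt0.
have E0 := half_energy_ge0.
rewrite -poweR_EFin -(poweRM _ c0 (E0 x)); apply: gt0_ler_poweR => //.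
- by rewrite in_itv/= leey andbT E0.
- by rewrite in_itv/= leey andbT mule_ge0.
- exact: represents_half_energy.
Qed.

Lemma opB_bounded : opB_estimates p lam phi I.
Proof.
exists (Num.max inv_cst (energy_cst `^ 2^-1)) => x hx; split.
  apply: le_trans (opB_le hx) _; rewrite ler_wpM2r ?hnorm_ge0//.
  by rewrite le_max lexx.
move=> _; have [FB xB] := opBP hx.
apply: le_trans (represents_alpha_norm (spectral_proj_span hx) FB xB) _.
apply: lee_wpmul2r; first exact: poweR_ge0.
by rewrite lee_fin le_max lexx orbT.
Qed.

End SpectralSubspace.

Theorem theorem4 (R : realType) (p : problem R) (lam : int -> R)
    (phi : int -> preHH R) (hp : admissible p) (hphi : eigensystem p lam phi)
    (I : set int) (hI : I = [set i | i < 0] \/ I = [set i | 0 < i]) :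
  [/\ invertible_compressP p phi I,
      selfadjoint_bounded p (opB p phi I) &
      opB_estimates p lam phi I].
Proof.
have [hs basis orth _] := es_basis hphi.
have I_neq0 i : I i -> i != 0.
  by case: hI => ->; [move=> /lt_eqF ->|move=> /gt_eqF ->].
have phiHH0 i : i != 0 -> HH p (phi i) by move=> i0; case: (basis i) => //; left.
have phiHH i : I i -> HH p (phi i) by move=> /I_neq0/phiHH0.
have phi_gt0 i : I i -> 0 < ip p (phi i) (phi i).
  move=> Ii; have hi := phiHH _ Ii; rewrite lt_neqAle ip_ge0// andbT eq_sym.
  apply/eqP => /(hs.1 _ hi).1; apply: (basis i _).2; left; exact: I_neq0.
have phi_orth0 i j : i != 0 -> I j -> i != j -> ip p (phi i) (phi j) = 0.
  by move=> i0 Ij ij; apply: orth => //; left => //; exact: I_neq0.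
have phi_orth i j : I i -> I j -> i != j -> ip p (phi i) (phi j) = 0.
  by move=> /I_neq0; exact: phi_orth0.
have eig i j : I i -> I j -> (lam i + lam j) * ip p (projP (phi i)) (phi j) =
    lam j * ip p (phi i) (phi j) + hform p (phi i).1 (phi j).1.
  move=> Ii Ij; apply: (eigen_projP hp hs); apply: (es_eigen hphi); left; exact: I_neq0.
have [k k0 hk] := hform_bound hp.
have {}hk x : HH p x -> `|hform p x.1 x.1| <= k * ip p (projP x) x.
  by move=> hx; rewrite ip_projP//; apply: hk; case: hx.
have [e [m [i0 [Ii0 e1 m0 lam_m]]]] : exists e m i0,
    [/\ I i0, `|e| = 1 :> R, 0 < m & forall i, I i -> m <= e * lam i].
  case: hI => ->.
  - exists (-1), (- lam (-1)), (-1); split => //.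
    + by rewrite normrN1.
    + by rewrite oppr_gt0 (es_neg hphi).
    + move=> i /= i0; rewrite mulN1r lerN2; apply: (es_nondecreasing hphi) => //.
        by rewrite lt_eqF.
  - exists 1, (lam 1), 1; split => //.
    + by rewrite normr1.
    + by rewrite (es_pos hphi).
    + by move=> i /= i0; rewrite mul1r (es_nondecreasing hphi) ?gt_eqF// gtz0_ge1.
have I0 : I !=set0 by exists i0.
split.
- exact: (compressP_invertible hp hs I0 phiHH phi_gt0 phi_orth e1 m0 k0 lam_m eig hk).
- exact: (opB_selfadjoint hp hs I0 phiHH phi_gt0 phi_orth e1 m0 k0 lam_m eig hk).
- exact: (opB_bounded hp hs I0 phiHH phi_gt0 phi_orth e1 m0 k0 lam_m eig hk phiHH0
    I_neq0 phi_orth0).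
Qed.
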